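(* There exist complex coefficients $(c_l)_{l\in\mathbb{Z}}$, not all zero, with $c_l\to 0$ as $|l|\to\infty$, and a sequence of positive integers $n_k\to\infty$ such that $$\lim_{k\to\infty}\sum_{l=-n_k}^{n_k}c_l e^{ilx}=0\qquad\text{for every }x\in[0,2\pi].$$ *)

(* Defs.v *)
(* Stdlib world: the classical real numbers R, with Coquelicot's complex
   numbers C and filter-based limits. *)
From Stdlib Require Import Reals ZArith Lia.
From Coquelicot Require Import Coquelicot.

(* Coquelicot has no complex exponential. *)
Definition Cexp (z : C) : C :=
  Cmult (RtoC (exp (Re z))) (cos (Im z), sin (Im z)).

(* The summation index is shifted: sum_n f m is f 0 + ... + f m (m + 1 terms),
   so j = 0, ..., 2n corresponds to l = j - n = -n, ..., n. *)
Definition symm_partial_sum (c : Z -> C) (n : nat) (x : R) : C :=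
  sum_n (fun j : nat =>
           let l := (Z.of_nat j - Z.of_nat n)%Z in
           Cmult (c l) (Cexp (Cmult (Cmult Ci (RtoC (IZR l))) (RtoC x))))
        (2 * n).

(* The filter on Z of "|l| -> infinity", i.e. of cofinite sets. *)
Definition Z_at_infinity (P : Z -> Prop) : Prop :=
  exists N : nat, forall l : Z, (Z.of_nat N <= Z.abs l)%Z -> P l.

Global Instance Z_at_infinity_filter : ProperFilter Z_at_infinity.
Proof.
constructor.
- intros P [N HN]; exists (Z.of_nat N); apply HN; lia.
- constructor.
  + exists O; intros l _; exact I.
  + intros P Q [N HN] [M HM]; exists (N + M)%nat; intros l Hl.
    split; [apply HN | apply HM]; lia.
  + intros P Q HPQ [N HN]; exists N; intros l Hl; apply HPQ, HN, Hl.
Qed.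

(* Main.v *)
Require Import Defs.
From Stdlib Require Import Reals ZArith.
From Coquelicot Require Import Coquelicot.
From Stdlib Require Import Lia Lra List Psatz ClassicalEpsilon.
Import ListNotations.
Open Scope R_scope.

(** The series is the limit of trigonometric polynomials f_k approximating exact functions
    F_{k+1}(x) = F_k(x) G_k(N_k x), with N_k growing fast.  The kernel G_k has mean 1, all its
    other Fourier coefficients are small, and some partial sum S G_k of its Fourier series is
    small wherever G_k does not vanish.  Then S f_{k+1} is about f_k(x) (S G_k)(N_k x) along a
    suitable partial sum: if all G_k(N_k x) are nonzero, then S G_k is always small at N_k x;
    otherwise F_k(x) = 0 from some k on.  Exact vanishing is essential here, so the F_k are not
    polynomials; they are approximated in the l1 norm of Fourier coefficients, for which
    partial sums are contractions.

    To build the kernel, take Q supported near 0 with coefficients 1 at 0 and -1/2 at 1 and -1: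
    its first partial sum 1 - cos y is small on the support.  The other coefficients are
    flattened by composing Q with N x + (phase), where the phase of slope t L^i is switched on
    or off according to the sign of sin (L^i x), for i < d.  The transition zones are cut out
    by factors vanishing at the zeros of the sine, so that every function stays in the Wiener
    algebra, and each switch multiplies the non-constant modes of Q by coefficients at most 3/4. *)

(** * Trigonometric polynomials as lists of monomials *)

(** The smallness of the partial sum is a pointwise condition, while flattening spreads frequencies,
    and the two conflict: in a sum of two shifted copies of [Q], one copy may be nonzero where the
    partial sum of the other is large. Hence the two switches of each scale have disjoint supports.
    At every point the kernel is then a constant times a weight in [0, 1] times one value [Q phi],
    and the same weight and [phi] serve for the partial sum 1 - cos. On a nonzero mode of [Q], the
    two branches of a scale have disjoint spectra, so coefficients are multiplied and never added,
    which gives (3/4)^d after [d] scales. Mode 0 does not see the phase and receives the sum of the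
    two switches, 1 minus a product of squared cosines: its mean is 1 - 2^-p and its other
    coefficients are at most 2^-p, so it stays nearly constant and can be normalised. The parameters
    are chosen in this order: [d] from the norm of [Q], then [p] from [d], and only then the
    accuracy of the polynomials, whose degrees fix the frequencies. *)

Definition E (t : R) : C := (cos t, sin t).

Lemma E_plus (s t : R) : E (s + t) = (E s * E t)%C.
Proof.
unfold E, Cmult; simpl; rewrite cos_plus, sin_plus.
f_equal; ring.
Qed.

Lemma E_0 : E 0 = 1%C.
Proof. unfold E; now rewrite cos_0, sin_0. Qed.

Lemma Cmod_E (t : R) : Cmod (E t) = 1.
Proof.
unfold Cmod, E; simpl fst; simpl snd.
replace (cos t ^ 2 + sin t ^ 2) with 1; [apply sqrt_1|].
generalize (sin2_cos2 t); unfold Rsqr; intros; nra.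
Qed.

Lemma Cexp_E (l : Z) (x : R) : Cexp (Ci * RtoC (IZR l) * RtoC x)%C = E (IZR l * x).
Proof.
unfold Cexp, E, Ci, Cmult, RtoC, Re, Im; simpl.
replace ((0 * IZR l - 1 * 0) * x - (0 * 0 + 1 * IZR l) * 0) with 0 by ring.
replace ((0 * IZR l - 1 * 0) * 0 + (0 * 0 + 1 * IZR l) * x) with (IZR l * x) by ring.
rewrite exp_0; f_equal; ring.
Qed.

Lemma cos_IZR_E (l : Z) (y : R) : (E (IZR l * y) + E (IZR (- l) * y))%C = RtoC (2 * cos (IZR l * y)).
Proof.
unfold E; rewrite opp_IZR, <- Ropp_mult_distr_l, cos_neg, sin_neg.
unfold Cplus, RtoC; simpl; f_equal; ring.
Qed.

Definition trigpoly : Type := list (Z * C).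

Definition lsum (g : Z * C -> C) (p : trigpoly) : C := fold_right (fun e s => g e + s)%C 0%C p.

Definition eval (p : trigpoly) (x : R) : C := lsum (fun e => snd e * E (IZR (fst e) * x))%C p.

Definition coef (p : trigpoly) (l : Z) : C := lsum (fun e => if Z.eq_dec (fst e) l then snd e else 0%C) p.

(** Entries of equal frequency are not merged, so this only bounds the l1 norm of the coefficients
    from above. In return it is exactly additive on concatenations and multiplicative on
    products. *)
Definition norm1 (p : trigpoly) : R := fold_right (fun e s => Cmod (snd e) + s) 0 p.

Definition cut (m : Z) (p : trigpoly) : trigpoly := filter (fun e => Z.leb (Z.abs (fst e)) m) p.

Definition degle (D : Z) (p : trigpoly) : Prop := forall e, In e p -> (Z.abs (fst e) <= D)%Z.

Definition smon (b : Z) (c : C) (p : trigpoly) : trigpoly :=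
  map (fun e => ((fst e + b)%Z, (c * snd e)%C)) p.

Definition dil (N : Z) (p : trigpoly) : trigpoly := map (fun e => ((N * fst e)%Z, snd e)) p.

Definition rot (a : R) (p : trigpoly) : trigpoly :=
  map (fun e => (fst e, snd e * E (IZR (fst e) * a))%C) p.

(* [blk Psi N q] is the trigonometric polynomial sum_(j, c in q) c e^{ijNx} Psi_j(x). *)
Definition blk (Psi : Z -> trigpoly) (N : Z) (q : trigpoly) : trigpoly :=
  flat_map (fun e => smon (N * fst e) (snd e) (Psi (fst e))) q.

Definition mul (p q : trigpoly) : trigpoly := flat_map (fun e => smon (fst e) (snd e) p) q.

Lemma lsum_app (g : Z * C -> C) (p q : trigpoly) : lsum g (p ++ q) = (lsum g p + lsum g q)%C.
Proof. induction p as [|e p IH]; simpl; [ring|rewrite IH; ring]. Qed.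

Lemma lsum_flat_map (g : Z * C -> C) (h : Z * C -> trigpoly) (p : trigpoly) :
  lsum g (flat_map h p) = lsum (fun e => lsum g (h e)) p.
Proof. induction p as [|e p IH]; simpl; [easy|now rewrite lsum_app, IH]. Qed.

Lemma lsum_map (g : Z * C -> C) (h : Z * C -> Z * C) (p : trigpoly) :
  lsum g (map h p) = lsum (fun e => g (h e)) p.
Proof. induction p as [|e p IH]; simpl; [easy|now rewrite IH]. Qed.

Lemma lsum_ext (g h : Z * C -> C) (p : trigpoly) :
  (forall e, In e p -> g e = h e) -> lsum g p = lsum h p.
Proof.
induction p as [|e p IH]; simpl; intros H; [easy|].
rewrite (H e), IH; auto.
Qed.

Lemma lsum_scal (c : C) (g : Z * C -> C) (p : trigpoly) : lsum (fun e => c * g e)%C p = (c * lsum g p)%C.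
Proof. induction p as [|e p IH]; simpl; [ring|rewrite IH; ring]. Qed.

Lemma eval_app (p q : trigpoly) (x : R) : eval (p ++ q) x = (eval p x + eval q x)%C.
Proof. apply lsum_app. Qed.

Lemma coef_app (p q : trigpoly) (l : Z) : coef (p ++ q) l = (coef p l + coef q l)%C.
Proof. apply lsum_app. Qed.

Lemma norm1_app (p q : trigpoly) : norm1 (p ++ q) = norm1 p + norm1 q.
Proof. induction p as [|e p IH]; simpl; [ring|rewrite IH; ring]. Qed.

Lemma norm1_ge_0 (p : trigpoly) : 0 <= norm1 p.
Proof. induction p as [|e p IH]; simpl; [lra|generalize (Cmod_ge_0 (snd e)); lra]. Qed.

Lemma eval_smon (b : Z) (c : C) (p : trigpoly) (x : R) :
  eval (smon b c p) x = (c * E (IZR b * x) * eval p x)%C.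
Proof.
unfold eval, smon; rewrite lsum_map, <- lsum_scal.
apply lsum_ext; intros e _; simpl.
rewrite plus_IZR, Rmult_plus_distr_r, E_plus; ring.
Qed.

Lemma coef_smon (b : Z) (c : C) (p : trigpoly) (l : Z) : coef (smon b c p) l = (c * coef p (l - b))%C.
Proof.
unfold coef, smon; rewrite lsum_map, <- lsum_scal.
apply lsum_ext; intros e _; simpl.
destruct Z.eq_dec as [H|H], Z.eq_dec as [H'|H']; try lia; ring.
Qed.

Lemma norm1_smon (b : Z) (c : C) (p : trigpoly) : norm1 (smon b c p) = Cmod c * norm1 p.
Proof. induction p as [|e p IH]; simpl; [ring|rewrite IH, Cmod_mult; ring]. Qed.

Lemma degle_smon (b : Z) (c : C) (p : trigpoly) (D : Z) :
  degle D p -> degle (D + Z.abs b) (smon b c p).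
Proof.
intros H e He; apply in_map_iff in He; destruct He as [e' [<- He]].
specialize (H _ He); simpl; lia.
Qed.

Lemma eval_dil (N : Z) (p : trigpoly) (x : R) : eval (dil N p) x = eval p (IZR N * x).
Proof.
unfold eval, dil; rewrite lsum_map.
apply lsum_ext; intros e _; simpl.
now rewrite mult_IZR, Rmult_comm with (r1 := IZR N), Rmult_assoc.
Qed.

Lemma norm1_dil (N : Z) (p : trigpoly) : norm1 (dil N p) = norm1 p.
Proof. induction p as [|e p IH]; simpl; [easy|now rewrite IH]. Qed.

Lemma coef_dil_opp (p : trigpoly) (l : Z) : coef (dil (-1) p) l = coef p (- l).
Proof.
unfold coef, dil; rewrite lsum_map; apply lsum_ext; intros e _; cbn [fst snd].
destruct Z.eq_dec as [H|H], Z.eq_dec as [H'|H']; try lia; reflexivity.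
Qed.

Lemma eval_rot (a : R) (p : trigpoly) (x : R) : eval (rot a p) x = eval p (x + a).
Proof.
unfold eval, rot; rewrite lsum_map.
apply lsum_ext; intros e _; simpl.
rewrite Rmult_plus_distr_l, E_plus; ring.
Qed.

Lemma coef_rot (a : R) (p : trigpoly) (l : Z) : coef (rot a p) l = (E (IZR l * a) * coef p l)%C.
Proof.
unfold coef, rot; rewrite lsum_map, <- lsum_scal.
apply lsum_ext; intros e _; simpl.
destruct Z.eq_dec as [<-|H]; ring.
Qed.

Lemma norm1_rot (a : R) (p : trigpoly) : norm1 (rot a p) = norm1 p.
Proof. induction p as [|e p IH]; simpl; [easy|now rewrite IH, Cmod_mult, Cmod_E, Rmult_1_r]. Qed.

Lemma Cmod_eval_le (p : trigpoly) (x : R) : Cmod (eval p x) <= norm1 p.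
Proof.
induction p as [|e p IH]; simpl; [rewrite Cmod_0; lra|].
eapply Rle_trans; [apply Cmod_triangle|].
rewrite Cmod_mult, Cmod_E, Rmult_1_r; now apply Rplus_le_compat_l.
Qed.

Lemma Cmod_coef_le (p : trigpoly) (l : Z) : Cmod (coef p l) <= norm1 p.
Proof.
induction p as [|e p IH]; simpl; [rewrite Cmod_0; lra|].
eapply Rle_trans; [apply Cmod_triangle|].
apply Rplus_le_compat; [|exact IH].
destruct Z.eq_dec; [lra|rewrite Cmod_0; apply Cmod_ge_0].
Qed.

Lemma norm1_cut (m : Z) (p : trigpoly) : norm1 (cut m p) <= norm1 p.
Proof.
induction p as [|e p IH]; simpl; [lra|].
destruct (Z.abs (fst e) <=? m)%Z; simpl; [lra|generalize (Cmod_ge_0 (snd e)); lra].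
Qed.

Lemma cut_app (m : Z) (p q : trigpoly) : cut m (p ++ q) = cut m p ++ cut m q.
Proof. apply filter_app. Qed.

Lemma coef_out (D : Z) (p : trigpoly) (l : Z) : degle D p -> (D < Z.abs l)%Z -> coef p l = 0%C.
Proof.
intros H Hl; unfold coef.
induction p as [|e p IH]; simpl; [easy|].
rewrite IH by (intros e' He'; apply H; now right).
destruct Z.eq_dec as [He|He]; [|ring].
specialize (H e (or_introl eq_refl)); lia.
Qed.

Lemma degle_app (D : Z) (p q : trigpoly) : degle D p -> degle D q -> degle D (p ++ q).
Proof. intros Hp Hq e He; apply in_app_or in He; destruct He; auto. Qed.

Lemma degle_le (D D' : Z) (p : trigpoly) : (D <= D')%Z -> degle D p -> degle D' p.
Proof. intros HD H e He; specialize (H e He); lia. Qed.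

Lemma degle_ex (p : trigpoly) : exists D, (0 <= D)%Z /\ degle D p.
Proof.
induction p as [|e p [D [HD IH]]]; [exists 0%Z; split; [lia|easy]|].
exists (D + Z.abs (fst e))%Z; split; [lia|].
intros e' [<-|He]; [lia|specialize (IH e' He); lia].
Qed.

Lemma eval_mul (p q : trigpoly) (x : R) : eval (mul p q) x = (eval p x * eval q x)%C.
Proof.
unfold mul; unfold eval at 1; rewrite lsum_flat_map.
unfold eval at 2; rewrite <- lsum_scal.
apply lsum_ext; intros e _.
change (eval (smon (fst e) (snd e) p) x = (eval p x * (snd e * E (IZR (fst e) * x)))%C).
rewrite eval_smon; ring.
Qed.

Lemma norm1_mul (p q : trigpoly) : norm1 (mul p q) = norm1 p * norm1 q.
Proof.
induction q as [|e q IH]; simpl; [ring|].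
rewrite norm1_app, norm1_smon, IH; ring.
Qed.

Lemma eval_blk (Psi : Z -> trigpoly) (N : Z) (q : trigpoly) (x : R) :
  eval (blk Psi N q) x =
  lsum (fun e => snd e * E (IZR (fst e) * (IZR N * x)) * eval (Psi (fst e)) x)%C q.
Proof.
unfold eval at 1, blk; rewrite lsum_flat_map.
apply lsum_ext; intros e _.
change (eval (smon (N * fst e) (snd e) (Psi (fst e))) x =
  snd e * E (IZR (fst e) * (IZR N * x)) * eval (Psi (fst e)) x)%C.
rewrite eval_smon, mult_IZR; do 3 f_equal; ring.
Qed.

Lemma eval_blk_const (p : trigpoly) (N : Z) (q : trigpoly) (x : R) :
  eval (blk (fun _ => p) N q) x = (eval p x * eval q (IZR N * x))%C.
Proof.
rewrite eval_blk; unfold eval at 3; rewrite <- lsum_scal.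
apply lsum_ext; intros e _; ring.
Qed.

Lemma norm1_blk (Psi : Z -> trigpoly) (N : Z) (q : trigpoly) (b : R) :
  (forall e, In e q -> norm1 (Psi (fst e)) <= b) -> norm1 (blk Psi N q) <= norm1 q * b.
Proof.
induction q as [|e q IH]; simpl; intros H; [lra|].
rewrite norm1_app, norm1_smon, Rmult_plus_distr_r.
apply Rplus_le_compat; [|apply IH; auto].
apply Rmult_le_compat_l; [apply Cmod_ge_0|apply H; auto].
Qed.

Lemma degle_blk (Psi : Z -> trigpoly) (N : Z) (q : trigpoly) (D J : Z) :
  (forall e, In e q -> degle D (Psi (fst e))) -> degle J q ->
  degle (D + Z.abs N * J) (blk Psi N q).
Proof.
intros HD HJ e He; apply in_flat_map in He; destruct He as [e' [He' He]].
apply (degle_smon _ _ _ _ (HD e' He')) in He.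
specialize (HJ e' He'); nia.
Qed.

(** The windows of radius [D] around the multiples of [N] are disjoint, so after a shift by [D]
    Euclidean division finds the window of [l]. *)
Lemma block_index (D N j l : Z) :
  (0 <= D)%Z -> (2 * D < N)%Z -> (Z.abs (l - N * j) <= D)%Z -> j = ((l + D) / N)%Z.
Proof.
intros HD HN Hj.
apply Z.div_unique with (l + D - N * j)%Z; [left|]; lia.
Qed.

Lemma coef_blk (Psi : Z -> trigpoly) (N : Z) (q : trigpoly) (D l : Z) :
  (0 <= D)%Z -> (2 * D < N)%Z -> (forall e, In e q -> degle D (Psi (fst e))) ->
  coef (blk Psi N q) l =
  (coef q ((l + D) / N) * coef (Psi ((l + D) / N)%Z) (l - N * ((l + D) / N)))%C.
Proof.
intros HD HN H; set (j := ((l + D) / N)%Z).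
induction q as [|e q IH]; [unfold coef; simpl; ring|].
simpl blk; rewrite coef_app, coef_smon, IH by (intros e' He'; apply H; now right).
change (coef (e :: q) j) with ((if Z.eq_dec (fst e) j then snd e else 0) + coef q j)%C.
destruct Z.eq_dec as [He|He]; [rewrite He; ring|].
rewrite (coef_out D); [ring|apply H; now left|].
destruct (Z_lt_le_dec D (Z.abs (l - N * fst e))) as [Hl|Hl]; [exact Hl|].
elim He; now apply block_index.
Qed.

Lemma cut_smon_all (m b : Z) (c : C) (p : trigpoly) (D : Z) :
  degle D p -> (D + Z.abs b <= m)%Z -> cut m (smon b c p) = smon b c p.
Proof.
intros H Hm; apply (degle_smon b c) in H; revert H.
generalize (smon b c p) as r; clear p.
induction r as [|e r IH]; intros H; [easy|]; simpl.
rewrite (proj2 (Z.leb_le (Z.abs (fst e)) m)) by (specialize (H e (or_introl eq_refl)); lia).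
f_equal; apply IH; intros e' He'; apply H; now right.
Qed.

Lemma cut_smon_none (m b : Z) (c : C) (p : trigpoly) (D : Z) :
  degle D p -> (m < Z.abs b - D)%Z -> cut m (smon b c p) = [].
Proof.
intros H Hm; induction p as [|e p IH]; [easy|].
specialize (IH (fun e' He' => H e' (or_intror He'))).
specialize (H e (or_introl eq_refl)); simpl.
now rewrite (proj2 (Z.leb_gt (Z.abs (fst e + b)) m)) by lia.
Qed.

(** The cut falls between blocks: block [m] ends by [m N + D], before block [m + 1] can start at
    [(m + 1) N - D]. This is what makes the selected partial sums explicit: only the factor carrying
    the high frequencies is truncated. *)
Lemma cut_blk (Psi : Z -> trigpoly) (N : Z) (q : trigpoly) (D m : Z) :
  (0 <= D)%Z -> (2 * D < N)%Z -> (forall e, In e q -> degle D (Psi (fst e))) ->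
  cut (m * N + D) (blk Psi N q) = blk Psi N (cut m q).
Proof.
intros HD HN H; induction q as [|e q IH]; [easy|].
simpl; rewrite cut_app, IH by (intros e' He'; apply H; now right).
assert (He := H e (or_introl eq_refl)).
destruct (Z.leb_spec (Z.abs (fst e)) m) as [Hm|Hm]; simpl.
- now rewrite (cut_smon_all _ _ _ _ D) by (auto; nia).
- now rewrite (cut_smon_none _ _ _ _ D) by (auto; nia).
Qed.

(** * The Wiener algebra *)

Definition climit (u : nat -> C) (l : C) : Prop :=
  forall eps, 0 < eps -> exists n0, forall n, (n0 <= n)%nat -> Cmod (u n - l) < eps.

Lemma climit_ext (u v : nat -> C) (l : C) : (forall n, u n = v n) -> climit u l -> climit v l.
Proof.
intros H Hu eps He; destruct (Hu eps He) as [n0 Hn0]; exists n0; intros n Hn.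
rewrite <- H; auto.
Qed.

Lemma climit_plus (u v : nat -> C) (a b : C) :
  climit u a -> climit v b -> climit (fun n => u n + v n)%C (a + b)%C.
Proof.
intros Hu Hv eps He.
destruct (Hu (eps / 2)) as [n1 H1]; [lra|].
destruct (Hv (eps / 2)) as [n2 H2]; [lra|].
exists (n1 + n2)%nat; intros n Hn.
replace (u n + v n - (a + b))%C with ((u n - a) + (v n - b))%C by ring.
eapply Rle_lt_trans; [apply Cmod_triangle|].
specialize (H1 n); specialize (H2 n); lra || (assert (Cmod (u n - a) < eps / 2) by (apply H1; lia);
assert (Cmod (v n - b) < eps / 2) by (apply H2; lia); lra).
Qed.

Lemma climit_mult (u v : nat -> C) (a b : C) :
  climit u a -> climit v b -> climit (fun n => u n * v n)%C (a * b)%C.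
Proof.
intros Hu Hv eps He.
assert (Ha := Cmod_ge_0 a); assert (Hb := Cmod_ge_0 b).
set (K := Cmod a + Cmod b + 2).
destruct (Hu (Rmin 1 (eps / (2 * K)))) as [n1 H1].
{ apply Rmin_pos; [lra|apply Rdiv_lt_0_compat; unfold K; lra]. }
destruct (Hv (Rmin 1 (eps / (2 * K)))) as [n2 H2].
{ apply Rmin_pos; [lra|apply Rdiv_lt_0_compat; unfold K; lra]. }
exists (n1 + n2)%nat; intros n Hn.
specialize (H1 n ltac:(lia)); specialize (H2 n ltac:(lia)).
replace (u n * v n - a * b)%C with ((u n - a) * (v n - b) + ((u n - a) * b + a * (v n - b)))%C by ring.
eapply Rle_lt_trans; [apply Cmod_triangle|].
eapply Rle_lt_trans; [apply Rplus_le_compat_l, Cmod_triangle|].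
rewrite !Cmod_mult.
assert (Hm1 := Rmin_l 1 (eps / (2 * K))); assert (Hm2 := Rmin_r 1 (eps / (2 * K))).
assert (Hk : eps / (2 * K) * (2 * K) = eps) by (field; unfold K; lra).
set (d := eps / (2 * K)) in *.
assert (Hx := Cmod_ge_0 (u n - a)); assert (Hy := Cmod_ge_0 (v n - b)).
set (X := Cmod (u n - a)%C) in *; set (Y := Cmod (v n - b)%C) in *.
unfold K in Hk.
assert (X * Y <= X) by nra.
assert (X * Cmod b <= d * Cmod b) by (apply Rmult_le_compat_r; lra).
assert (Cmod a * Y <= Cmod a * d) by (apply Rmult_le_compat_l; lra).
nra.
Qed.

Lemma climit_Cmod_le (u : nat -> C) (l : C) (b : R) :
  (forall n, Cmod (u n) <= b) -> climit u l -> Cmod l <= b.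
Proof.
intros Hb Hu; apply Rnot_lt_le; intros H.
destruct (Hu (Cmod l - b)) as [n Hn]; [lra|].
specialize (Hn n (le_n n)); specialize (Hb n).
assert (Ht := Cmod_triangle (u n) (l - u n)).
replace (u n + (l - u n))%C with l in Ht by ring.
replace (l - u n)%C with (- (u n - l))%C in Ht by ring.
rewrite Cmod_opp in Ht; lra.
Qed.

Fixpoint parts (u : nat -> trigpoly) (n : nat) : trigpoly :=
  match n with O => [] | S n => parts u n ++ u n end.

(* The Fourier series of F converges absolutely, with l1-norm at most b. *)
Definition wiener (F : R -> C) (b : R) : Prop :=
  exists u : nat -> trigpoly, (forall n, norm1 (parts u n) <= b) /\
    forall x, climit (fun n => eval (parts u n) x) (F x).

Lemma wiener_ext (F G : R -> C) (b : R) : (forall x, F x = G x) -> wiener F b -> wiener G b.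
Proof.
intros H [u [Hu Hc]]; exists u; split; [easy|].
intros x; rewrite <- H; apply Hc.
Qed.

Lemma wiener_le (F : R -> C) (b b' : R) : b <= b' -> wiener F b -> wiener F b'.
Proof.
intros H [u [Hu Hc]]; exists u; split; [|easy].
intros n; specialize (Hu n); lra.
Qed.

Lemma wiener_trans (F G : R -> C) (a b : R) :
  wiener F a -> a <= b -> (forall x, F x = G x) -> wiener G b.
Proof. intros HF Hab HFG; exact (wiener_ext _ _ _ HFG (wiener_le _ _ _ Hab HF)). Qed.

Lemma wiener_nonneg (F : R -> C) (b : R) : wiener F b -> 0 <= b.
Proof. intros [u [Hu _]]; exact (Hu 0%nat). Qed.

Lemma wiener_eval (p : trigpoly) : wiener (eval p) (norm1 p).
Proof.
set (u := fun n => match n with O => p | S _ => [] end).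
assert (Hp : forall n, parts u (S n) = p).
{ induction n as [|n IH]; [easy|].
  change (parts u (S n) ++ [] = p); now rewrite app_nil_r. }
exists u; split.
- intros [|n]; [apply norm1_ge_0|rewrite Hp; lra].
- intros x eps He; exists 1%nat; intros [|n] Hn; [lia|].
  rewrite Hp; replace (eval p x - eval p x)%C with (RtoC 0) by ring; now rewrite Cmod_0.
Qed.

Lemma wiener_sup (F : R -> C) (b x : R) : wiener F b -> Cmod (F x) <= b.
Proof.
intros [u [Hu Hc]]; apply (climit_Cmod_le _ _ _) with (2 := Hc x).
intros n; eapply Rle_trans; [apply Cmod_eval_le|apply Hu].
Qed.

Lemma wiener_plus (F G : R -> C) (a b : R) :
  wiener F a -> wiener G b -> wiener (fun x => F x + G x)%C (a + b).
Proof.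
intros [u [Hu Hu']] [v [Hv Hv']].
set (w := fun n => u n ++ v n).
exists w; split.
- intros n; apply Rle_trans with (norm1 (parts u n) + norm1 (parts v n)).
  + right; induction n as [|n IH]; simpl; [ring|].
    unfold w at 2; rewrite !norm1_app, IH; ring.
  + specialize (Hu n); specialize (Hv n); lra.
- intros x; apply climit_ext with (2 := climit_plus _ _ _ _ (Hu' x) (Hv' x)).
  induction n as [|n IH]; simpl; [unfold eval; simpl; ring|].
  unfold w at 2; rewrite !eval_app, <- IH; ring.
Qed.

Lemma wiener_mult (F G : R -> C) (a b : R) :
  wiener F a -> wiener G b -> wiener (fun x => F x * G x)%C (a * b).
Proof.
intros [u [Hu Hu']] [v [Hv Hv']].
(* Increments of the product of the partial sums; with this choice the norms of the partial sums
   multiply exactly. *)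
set (w := fun n => mul (u n) (parts v n) ++ mul (parts u (S n)) (v n)).
exists w; split.
- intros n; apply Rle_trans with (norm1 (parts u n) * norm1 (parts v n)).
  + right; induction n as [|n IH]; simpl; [ring|].
    unfold w at 2; simpl; rewrite !norm1_app, !norm1_mul, IH, norm1_app; ring.
  + apply Rmult_le_compat; auto using norm1_ge_0.
- intros x; apply climit_ext with (2 := climit_mult _ _ _ _ (Hu' x) (Hv' x)).
  induction n as [|n IH]; simpl; [unfold eval; simpl; ring|].
  unfold w at 2; simpl; rewrite !eval_app, !eval_mul, <- IH, eval_app; ring.
Qed.

Lemma wiener_const (c : C) : wiener (fun _ => c) (Cmod c).
Proof.
apply wiener_ext with (eval [(0%Z, c)]).
- intros x; unfold eval; simpl; rewrite Rmult_0_l, E_0; ring.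
- apply wiener_le with (norm1 [(0%Z, c)]); [simpl; lra|apply wiener_eval].
Qed.

Lemma wiener_scal (c : C) (F : R -> C) (b : R) : wiener F b -> wiener (fun x => c * F x)%C (Cmod c * b).
Proof. intros H; apply wiener_mult; [apply wiener_const|exact H]. Qed.

Lemma wiener_minus (F G : R -> C) (a b : R) :
  wiener F a -> wiener G b -> wiener (fun x => F x - G x)%C (a + b).
Proof.
intros HF HG; apply (wiener_scal (- (1))) in HG.
rewrite Cmod_opp, Cmod_1, Rmult_1_l in HG.
apply wiener_ext with (2 := wiener_plus _ _ _ _ HF HG); intros x; ring.
Qed.

Lemma wiener_dil (N : Z) (F : R -> C) (b : R) : wiener F b -> wiener (fun x => F (IZR N * x)) b.
Proof.
intros [u [Hu Hc]]; exists (fun n => dil N (u n)).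
assert (Hd : forall n, parts (fun n => dil N (u n)) n = dil N (parts u n)).
{ induction n as [|n IH]; [easy|]; simpl; rewrite IH; unfold dil; now rewrite map_app. }
split.
- intros n; now rewrite Hd, norm1_dil.
- intros x; apply climit_ext with (2 := Hc (IZR N * x)).
  intros n; now rewrite Hd, eval_dil.
Qed.

Lemma wiener_rot (a : R) (F : R -> C) (b : R) : wiener F b -> wiener (fun x => F (x + a)) b.
Proof.
intros [u [Hu Hc]]; exists (fun n => rot a (u n)).
assert (Hd : forall n, parts (fun n => rot a (u n)) n = rot a (parts u n)).
{ induction n as [|n IH]; [easy|]; simpl; rewrite IH; unfold rot; now rewrite map_app. }
split.
- intros n; now rewrite Hd, norm1_rot.
- intros x; apply climit_ext with (2 := Hc (x + a)).
  intros n; now rewrite Hd, eval_rot.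
Qed.

Lemma parts_add (u : nat -> trigpoly) (n m : nat) :
  parts u (n + m) = parts u n ++ parts (fun i => u (n + i)%nat) m.
Proof.
induction m as [|m IH]; [now rewrite Nat.add_0_r; simpl; rewrite app_nil_r|].
rewrite Nat.add_succ_r; simpl; now rewrite IH, app_assoc.
Qed.

(** If every index were followed by a stretch of norm above [eta], the norms of the partial sums
    would exceed [b]. So some tail has norm at most [eta], and it represents the difference. *)
Lemma wiener_split (F : R -> C) (b eta : R) : 0 < eta -> wiener F b ->
  exists p, norm1 p <= b /\ wiener (fun x => F x - eval p x)%C eta.
Proof.
intros He [u [Hu Hc]].
assert (Hn : exists n, forall m, norm1 (parts u (n + m)) <= norm1 (parts u n) + eta).
{ apply NNPP; intros Hn.
  assert (Hk : forall k, exists n, INR k * eta <= norm1 (parts u n)).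
  { induction k as [|k [n IH]]; [exists 0%nat; simpl; lra|].
    apply NNPP; intros Hk; apply Hn; exists n; intros m.
    apply Rnot_lt_le; intros Hm; apply Hk; exists (n + m)%nat.
    rewrite S_INR; lra. }
  destruct (INR_unbounded (b / eta)) as [k Hb].
  destruct (Hk k) as [n Hkn]; specialize (Hu n).
  assert (b < INR k * eta); [|lra].
  apply (Rmult_lt_compat_r eta) in Hb; [|exact He].
  replace (b / eta * eta) with b in Hb by (field; lra); exact Hb. }
destruct Hn as [n Hn]; exists (parts u n); split; [apply Hu|].
exists (fun i => u (n + i)%nat); split.
- intros m; specialize (Hn m); rewrite parts_add, norm1_app in Hn; lra.
- intros x eps Heps; destruct (Hc x eps Heps) as [n0 Hn0]; exists n0; intros m Hm.
  specialize (Hn0 (n + m)%nat ltac:(lia)); rewrite parts_add, eval_app in Hn0.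
  match goal with |- Cmod ?a < _ => match type of Hn0 with Cmod ?b < _ => replace a with b by ring end end.
  exact Hn0.
Qed.

(** * Square roots in the Wiener algebra *)

Fixpoint sqrt_iter (t : R) (n : nat) : R :=
  match n with O => 0 | S n => (t + sqrt_iter t n ^ 2) / 2 end.

(* With e_n the error, e_{n+1} <= e_n (1 - e_n / 2). *)
Lemma sqrt_iter_bounds (t : R) (n : nat) : 0 <= t <= 1 ->
  0 <= sqrt_iter t n /\
  0 <= 1 - sqrt (1 - t) - sqrt_iter t n <= 2 / (INR n + 2).
Proof.
intros Ht.
assert (Hs0 := sqrt_pos (1 - t)).
assert (Hs1 : sqrt (1 - t) <= 1) by (rewrite <- sqrt_1 at 2; apply sqrt_le_1; lra).
assert (Hss : sqrt (1 - t) * sqrt (1 - t) = 1 - t) by (apply sqrt_sqrt; lra).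
set (s := sqrt (1 - t)) in *.
induction n as [|n [IH1 [IH2 IH3]]].
{ simpl; split; [lra|]. replace (2 / (0 + 2)) with 1 by field; lra. }
change (sqrt_iter t (S n)) with ((t + sqrt_iter t n ^ 2) / 2).
assert (Hq : exists q, q = sqrt_iter t n) by eauto; destruct Hq as [q Hq].
rewrite <- Hq in *; clear Hq.
assert (He : 1 - s - (t + q ^ 2) / 2 = (1 - s - q) * (1 - s + q) / 2) by nra.
rewrite He; split; [nra|].
split; [nra|].
rewrite S_INR; assert (Hn := pos_INR n); set (k := INR n) in *; clearbody k.
apply Rle_trans with ((1 - s - q) * (1 - (1 - s - q) / 2)); [nra|].
set (e := 1 - s - q) in *.
assert (He1 : e <= 1) by (unfold e; lra).
set (d := 2 / (k + 2)) in *.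
assert (Hd : d * (k + 2) = 2) by (unfold d; field; lra).
assert (Hd1 : d <= 1) by (apply Rmult_le_reg_r with (k + 2); lra).
apply Rle_trans with (d * (1 - d / 2)); [nra|].
apply Rmult_le_reg_r with (k + 1 + 2); [lra|].
replace (2 / (k + 1 + 2) * (k + 1 + 2)) with 2 by (field; lra).
assert (0 <= d) by (apply Rmult_le_reg_r with (k + 2); lra).
apply Rmult_le_reg_r with (k + 2); [lra|].
assert (d * (1 - d / 2) * (k + 2) = 2 - d) by nra.
nra.
Qed.

(** 1 - sqrt (1 - t) is a fixed point of q -> (t + q^2) / 2. The increments of the iteration satisfy
    d_{n+1} = d_n (q_n + q_{n+1}) / 2, without any subtraction, so the norms obey the same recursion
    with [norm1 p] in place of [t] and stay at most 1. *)
Lemma wiener_one_minus_sqrt (p : trigpoly) (t : R -> R) :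
  norm1 p <= 1 -> (forall x, 0 <= t x <= 1) -> (forall x, eval p x = RtoC (t x)) ->
  wiener (fun x => RtoC (1 - sqrt (1 - t x))) 1.
Proof.
intros Hp Ht Hpt.
pose (step := fun s : trigpoly * trigpoly =>
  let (q, d) := s in (q ++ d, smon 0 (RtoC (1/2)) (mul d (q ++ (q ++ d))))).
pose (st := fun n => Nat.iter n step ([], smon 0 (RtoC (1/2)) p)).
pose (u := fun n => snd (st n)).
assert (Hst : forall n, st n = (parts u n, u n)).
{ intros n; unfold u; rewrite (surjective_pairing (st n)) at 1; f_equal.
  induction n as [|n IH]; [easy|].
  simpl; rewrite <- IH; destruct (st n) as [q d]; reflexivity. }
assert (Hu : forall n, u (S n) = smon 0 (RtoC (1/2)) (mul (u n) (parts u n ++ (parts u n ++ u n)))).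
{ intros n; unfold u at 1; change (st (S n)) with (step (st n)); rewrite Hst; reflexivity. }
assert (Hhalf : Cmod (RtoC (1/2)) = 1/2) by (rewrite Cmod_R; apply Rabs_pos_eq; lra).
assert (Hev : forall x n, eval (parts u n) x = RtoC (sqrt_iter (t x) n) /\
   eval (u n) x = RtoC (sqrt_iter (t x) (S n) - sqrt_iter (t x) n)).
{ intros x; induction n as [|n [IH1 IH2]].
  - split; [easy|]; change (u 0%nat) with (smon 0 (RtoC (1/2)) p).
    rewrite eval_smon, Hpt, Rmult_0_l, E_0, Cmult_1_r, <- RtoC_mult; f_equal; simpl; field.
  - assert (H1 : eval (parts u (S n)) x = RtoC (sqrt_iter (t x) (S n))).
    { simpl parts; rewrite eval_app, IH1, IH2, <- RtoC_plus; f_equal; ring. }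
    split; [exact H1|].
    rewrite Hu, eval_smon, eval_mul, eval_app, IH2, Rmult_0_l, E_0.
    change (parts u n ++ u n) with (parts u (S n)).
    rewrite H1, IH1, Cmult_1_r, <- RtoC_plus, <- !RtoC_mult; f_equal.
    change (sqrt_iter (t x) (S (S n))) with ((t x + sqrt_iter (t x) (S n) ^ 2) / 2).
    assert (Hx : t x = 2 * sqrt_iter (t x) (S n) - sqrt_iter (t x) n ^ 2) by (simpl; field).
    revert Hx; generalize (sqrt_iter (t x) (S n)); intros b.
    generalize (sqrt_iter (t x) n); intros a Hx; rewrite Hx; field. }
assert (Hn : forall n, norm1 (parts u n) + norm1 (u n) = (norm1 p + norm1 (parts u n) ^ 2) / 2
   /\ norm1 (parts u n) <= 1).
{ induction n as [|n [IH1 IH2]].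
  - split; [|simpl; lra]. change (u 0%nat) with (smon 0 (RtoC (1/2)) p).
    rewrite norm1_smon, Hhalf; simpl; field.
  - assert (H1 : norm1 (parts u (S n)) = norm1 (parts u n) + norm1 (u n))
      by (simpl; apply norm1_app).
    assert (Hq := norm1_ge_0 (parts u n)).
    split; [|rewrite H1, IH1; nra].
    rewrite Hu, norm1_smon, norm1_mul, norm1_app, Hhalf.
    change (parts u n ++ u n) with (parts u (S n)); rewrite H1; nra. }
exists u; split; [intros n; apply Hn|].
intros x eps Heps.
destruct (INR_unbounded (2 / eps)) as [n0 Hn0]; exists n0; intros n Hle.
rewrite (proj1 (Hev x n)), <- RtoC_minus, Cmod_R.
destruct (sqrt_iter_bounds (t x) n (Ht x)) as [_ [H1 H2]].
rewrite Rabs_minus_sym, Rabs_pos_eq by exact H1.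
apply Rle_lt_trans with (1 := H2).
apply le_INR in Hle; assert (H0 := pos_INR n).
apply Rmult_lt_reg_r with (INR n + 2); [lra|].
replace (2 / (INR n + 2) * (INR n + 2)) with 2 by (field; lra).
apply (Rmult_lt_compat_r eps) in Hn0; [|exact Heps].
replace (2 / eps * eps) with 2 in Hn0 by (field; lra); nra.
Qed.

Definition cossq : trigpoly := [(0%Z, RtoC (1/2)); (2%Z, RtoC (1/4)); ((-2)%Z, RtoC (1/4))].

Lemma eval_cossq (x : R) : eval cossq x = RtoC (cos x ^ 2).
Proof.
assert (H := cos_IZR_E 2 x); change (- (2))%Z with (-2)%Z in H.
unfold eval, cossq, lsum; simpl fold_right; cbv beta; cbn [fst snd].
rewrite Rmult_0_l, E_0.
transitivity (RtoC (1/2) + RtoC (1/4) * (E (IZR 2 * x) + E (IZR (-2) * x)))%C; [ring|].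
rewrite H, <- RtoC_mult, <- RtoC_plus; f_equal.
rewrite cos_2a_cos; field.
Qed.

Lemma norm1_cossq : norm1 cossq = 1.
Proof. unfold norm1, cossq; simpl; rewrite !Cmod_R, !Rabs_pos_eq by lra; field. Qed.

Lemma wiener_abs_sin : wiener (fun x => RtoC (Rabs (sin x))) 2.
Proof.
assert (H : wiener (fun x => RtoC (1 - sqrt (1 - cos x ^ 2))) 1).
{ apply wiener_one_minus_sqrt with cossq; [rewrite norm1_cossq; lra| |apply eval_cossq].
  intros x; generalize (COS_bound x); intros; nra. }
apply wiener_le with (Cmod 1%C + 1); [rewrite Cmod_1; lra|].
apply wiener_ext with (2 := wiener_minus _ _ _ _ (wiener_const 1%C) H).
intros x; rewrite <- RtoC_minus; f_equal.
replace (1 - cos x ^ 2) with (Rsqr (sin x)).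
- rewrite sqrt_Rsqr_abs; ring.
- rewrite sin2; unfold Rsqr; ring.
Qed.

Definition sint : trigpoly := [(1%Z, (0, -1/2)); ((-1)%Z, (0, 1/2))].

Lemma eval_sint (x : R) : eval sint x = RtoC (sin x).
Proof.
unfold eval, sint, E, lsum; simpl.
rewrite Rmult_1_l; replace (-1 * x) with (- x) by ring; rewrite cos_neg, sin_neg.
unfold Cplus, Cmult, RtoC; simpl; f_equal; field.
Qed.

Lemma norm1_sint : norm1 sint = 1.
Proof.
unfold norm1, sint; simpl; unfold Cmod; simpl.
replace (0 * (0 * 1) + -1 / 2 * (-1 / 2 * 1)) with ((1/2) * (1/2)) by field.
replace (0 * (0 * 1) + 1 / 2 * (1 / 2 * 1)) with ((1/2) * (1/2)) by field.
rewrite sqrt_square by lra; field.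
Qed.

(** * Means over a period and a bump in the Wiener algebra *)

Lemma is_RInt_Re_monomial (l : Z) (c : C) :
  is_RInt (fun x => Re (c * E (IZR l * x))%C) 0 (2 * PI)
    (2 * PI * Re (if Z.eq_dec l 0 then c else 0%C)).
Proof.
destruct c as [a b].
apply is_RInt_ext with (fun x => a * cos (IZR l * x) - b * sin (IZR l * x)); [easy|].
destruct Z.eq_dec as [->|Hl].
- apply is_RInt_ext with (fun _ => a).
  { intros x _; rewrite Rmult_0_l, cos_0, sin_0.
    match goal with |- ?u = ?v => change (@eq R u v) end; ring. }
  simpl Re; replace (2 * PI * a) with (scal (2 * PI - 0) a)
    by (unfold scal; simpl; unfold mult; simpl; ring).
  apply (is_RInt_const (V := R_NormedModule)).
- assert (Hl' : IZR l <> 0) by now apply not_0_IZR.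
  pose (F := fun x => (a * sin (IZR l * x) + b * cos (IZR l * x)) / IZR l).
  replace (2 * PI * Re (RtoC 0)) with (minus (F (2 * PI)) (F 0)).
  2:{ unfold minus, plus, opp; simpl; unfold F.
      assert (Hs : sin (IZR l * PI) = 0) by (apply sin_eq_0_1; now exists l).
      replace (IZR l * (2 * PI)) with (2 * (IZR l * PI)) by ring.
      rewrite cos_2a_sin, sin_2a, Hs, !Rmult_0_r, sin_0, cos_0; unfold Re; simpl; field; auto. }
  apply (is_RInt_derive F).
  + intros x _; unfold F; auto_derive; [auto|field; auto].
  + intros x _; apply (ex_derive_continuous (V := R_NormedModule)); auto_derive; auto.
Qed.

Lemma is_RInt_Re_eval (p : trigpoly) :
  is_RInt (fun x => Re (eval p x)) 0 (2 * PI) (2 * PI * Re (coef p 0)).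
Proof.
induction p as [|e p IH].
- apply is_RInt_ext with (fun _ => 0); [easy|].
  change (Re (coef [] 0)) with 0; replace (2 * PI * 0) with (scal (2 * PI - 0) 0)
    by (unfold scal; simpl; unfold mult; simpl; ring).
  apply (is_RInt_const (V := R_NormedModule)).
- replace (2 * PI * Re (coef (e :: p) 0)) with
    (plus (2 * PI * Re (if Z.eq_dec (fst e) 0 then snd e else 0%C)) (2 * PI * Re (coef p 0)))
    by (unfold plus; simpl; unfold Re; simpl; ring).
  apply (is_RInt_plus (V := R_NormedModule)); [apply is_RInt_Re_monomial|exact IH].
Qed.

Lemma Re_coef_0_ge (p : trigpoly) (g : R -> R) :
  (forall x, g x <= Re (eval p x)) -> ex_RInt g 0 (2 * PI) ->
  RInt g 0 (2 * PI) <= 2 * PI * Re (coef p 0).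
Proof.
intros Hg Hi; generalize PI_RGT_0; intros HP.
apply (is_RInt_le g (fun x => Re (eval p x)) 0 (2 * PI)); [lra| |apply is_RInt_Re_eval|auto].
now apply (RInt_correct (V := R_CompleteNormedModule)).
Qed.

(** Multiplication by a monomial with unimodular coefficient moves the coefficient to frequency 0
    and turns it into [- Cmod k]; the minus sign is there because the comparison of means gives
    lower bounds. *)
Lemma Cmod_coef_le_sup (p : trigpoly) (l : Z) (b : R) :
  (forall x, Cmod (eval p x) <= b) -> Cmod (coef p l) <= b.
Proof.
intros Hb; set (k := coef p l).
destruct (Req_dec (Cmod k) 0) as [Hk|Hk].
{ rewrite Hk; eapply Rle_trans; [apply Cmod_ge_0|apply (Hb 0)]. }
assert (Hk0 := Cmod_ge_0 k).
set (z := (- (Cconj k / Cmod k))%C).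
assert (Hz : Cmod z = 1).
{ unfold z; rewrite Cmod_opp, Cmod_div by (intros H; apply Hk; now injection H).
  rewrite Cmod_conj, Cmod_R, Rabs_pos_eq by lra; field; auto. }
assert (H := Re_coef_0_ge (smon (- l) z p) (fun _ => - b)).
rewrite coef_smon in H; replace (0 - - l)%Z with l in H by ring; fold k in H.
replace (z * k)%C with (RtoC (- Cmod k)) in H.
2:{ assert (Hkk : (Cconj k * k)%C = RtoC (Cmod k * Cmod k)).
    { destruct k as [a b']; unfold Cmod, Cconj, Cmult, RtoC; simpl.
      rewrite sqrt_sqrt by nra; f_equal; ring. }
    assert (HkC : RtoC (Cmod k) <> RtoC 0) by (intros Hc; apply Hk; now injection Hc).
    unfold z; transitivity (- (Cconj k * k) / Cmod k)%C; [|now field].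
    rewrite Hkk, RtoC_mult, RtoC_opp; now field. }
assert (HP := PI_RGT_0); rewrite re_RtoC in H.
rewrite RInt_const in H; unfold scal in H; simpl in H; unfold mult in H; simpl in H.
assert (H' : (2 * PI - 0) * - b <= 2 * PI * - Cmod k).
{ apply H; [|apply (ex_RInt_const (V := R_NormedModule))].
  intros x; rewrite eval_smon.
  assert (Hm : Cmod (z * E (IZR (- l) * x) * eval p x)%C <= b).
  { rewrite !Cmod_mult, Hz, Cmod_E; specialize (Hb x); lra. }
  generalize (re_le_Cmod (z * E (IZR (- l) * x) * eval p x)%C); intros Hre.
  apply Rabs_le_between in Hre; lra. }
apply Ropp_le_cancel; apply Rmult_le_reg_l with (2 * PI); lra.
Qed.

Definition sin_pos (x : R) : R := (Rabs (sin x) + sin x) / 2.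

Lemma sin_pos_nonneg (x : R) : 0 <= sin_pos x.
Proof. unfold sin_pos; split_Rabs; lra. Qed.

Lemma sin_pos_neq_0 (x : R) : sin_pos x <> 0 -> 0 < sin x.
Proof. unfold sin_pos; split_Rabs; lra. Qed.

Lemma sin_pos_eq (x : R) : 0 <= sin x -> sin_pos x = sin x.
Proof. unfold sin_pos; split_Rabs; lra. Qed.

Lemma sin_pos_continuous (x : R) : continuous sin_pos x.
Proof.
apply (continuous_ext (fun x => (1/2) * (Rabs (sin x) + sin x))).
{ intros y; unfold sin_pos; simpl; field. }
apply (continuous_mult (K := R_AbsRing)); [apply continuous_const|].
apply (continuous_plus (V := R_NormedModule)).
- apply continuous_comp; [apply continuous_sin|apply continuous_Rabs].
- apply continuous_sin.
Qed.

Lemma wiener_sin_pos : wiener (fun x => RtoC (sin_pos x)) (3/2).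
Proof.
assert (Hs : wiener (fun x => RtoC (sin x)) 1).
{ apply wiener_ext with (1 := eval_sint); rewrite <- norm1_sint; apply wiener_eval. }
apply wiener_le with (Cmod (RtoC (1/2)) * (2 + 1)).
{ rewrite Cmod_R, Rabs_pos_eq; lra. }
apply wiener_ext with (2 := wiener_scal (RtoC (1/2)) _ _ (wiener_plus _ _ _ _ wiener_abs_sin Hs)).
intros x; rewrite <- RtoC_plus, <- RtoC_mult; f_equal; unfold sin_pos; field.
Qed.

(** For 0 < a < PI / 2 this is nonzero exactly within distance [a] of the multiples of 2 PI. It is
    built from positive parts of sines because the absolute value of the sine is in the Wiener
    algebra. *)
Definition bump (a y : R) : R := sin_pos (y + a) * sin_pos (a - y).

Lemma bump_nonneg (a y : R) : 0 <= bump a y.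
Proof. apply Rmult_le_pos; apply sin_pos_nonneg. Qed.

Lemma bump_even (a y : R) : bump a (- y) = bump a y.
Proof. unfold bump; rewrite Rmult_comm; f_equal; f_equal; ring. Qed.

(** Both sines are positive; their sum is 2 sin a cos y and their product is sin^2 a - sin^2 y. *)
Lemma bump_support (a y : R) : 0 < a < PI / 2 -> bump a y <> 0 ->
  0 < cos y /\ sin y ^ 2 <= sin a ^ 2.
Proof.
intros Ha H; unfold bump in H.
assert (H1 : 0 < sin (y + a)) by (apply sin_pos_neq_0; intros H'; rewrite H' in H; lra).
assert (H2 : 0 < sin (a - y)) by (apply sin_pos_neq_0; intros H'; rewrite H' in H; lra).
rewrite sin_plus in H1; rewrite sin_minus in H2.
assert (Hs : 0 < sin a) by (apply sin_gt_0; lra).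
assert (Hc : 0 < cos a) by (apply cos_gt_0; lra).
split; [nra|].
assert (Hy := sin2_cos2 y); assert (Ha' := sin2_cos2 a); unfold Rsqr in *.
assert (Hp := Rmult_lt_0_compat _ _ H1 H2); nra.
Qed.

Lemma wiener_bump (a : R) : wiener (fun y => RtoC (bump a y)) (9/4).
Proof.
apply wiener_le with (3/2 * (3/2)); [lra|].
assert (H := wiener_rot a _ _ wiener_sin_pos).
apply wiener_ext with (2 := wiener_mult _ _ _ _ H (wiener_dil (-1) _ _ H)).
intros y; cbv beta; rewrite <- RtoC_mult; unfold bump.
replace (a - y) with (-1 * y + a) by ring; reflexivity.
Qed.

Lemma bump_cos_continuous (a y : R) : continuous (fun y => bump a y * cos y) y.
Proof.
apply (continuous_mult (K := R_AbsRing)); [|apply continuous_cos].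
apply (continuous_mult (K := R_AbsRing)).
- apply (continuous_comp (fun y => y + a) sin_pos); [|apply sin_pos_continuous].
  apply (continuous_plus (V := R_NormedModule)); [apply continuous_id|apply continuous_const].
- apply (continuous_comp (fun y => a - y) sin_pos); [|apply sin_pos_continuous].
  apply (continuous_minus (V := R_NormedModule)); [apply continuous_const|apply continuous_id].
Qed.

Lemma bump_cos_bounds (a y : R) : 0 < a < PI / 2 ->
  0 <= bump a y * cos y <= bump a y.
Proof.
intros Ha; assert (H := bump_nonneg a y); assert (Hc := COS_bound y).
destruct (Req_dec (bump a y) 0) as [H0|H0]; [rewrite H0; lra|].
destruct (bump_support a y Ha H0); split; nra.
Qed.

Lemma ex_RInt_bump_cos (a u v : R) : ex_RInt (fun y => bump a y * cos y) u v.
Proof. apply (ex_RInt_continuous (V := R_CompleteNormedModule)); intros; apply bump_cos_continuous. Qed.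

Lemma RInt_bump_cos_pos (a : R) : 0 < a < PI / 2 ->
  0 < RInt (fun y => bump a y * cos y) 0 (2 * PI).
Proof.
intros Ha; rewrite <- (RInt_Chasles _ 0 a (2 * PI)) by apply ex_RInt_bump_cos.
apply Rplus_lt_le_0_compat.
- apply RInt_gt_0; [lra| |intros; apply bump_cos_continuous].
  intros y Hy; apply Rmult_lt_0_compat; [|apply cos_gt_0; lra].
  unfold bump; rewrite !sin_pos_eq.
  + apply Rmult_lt_0_compat; apply sin_gt_0; lra.
  + apply sin_ge_0; lra.
  + apply sin_ge_0; lra.
- apply RInt_ge_0; [lra|apply ex_RInt_bump_cos|].
  intros y _; now apply bump_cos_bounds.
Qed.

(** The bound [c] is uniform in [eta] because the coefficients will be divided by, and the norm of
    the result must not depend on the accuracy. *)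
Lemma bump_approx (a : R) : 0 < a < PI / 2 -> exists c, 0 < c /\
  forall eta, 0 < eta -> exists q, norm1 q <= 9/4 /\
    wiener (fun y => RtoC (bump a y) - eval q y)%C eta /\
    coef q (-1) = coef q 1 /\ c <= Re (coef q 0) /\ c <= Re (coef q 1).
Proof.
intros Ha; assert (HI := RInt_bump_cos_pos a Ha); assert (HP := PI_RGT_0).
assert (HI' : exists I : R, is_RInt (fun y => bump a y * cos y) 0 (2 * PI) I /\ 0 < I).
{ exists (RInt (fun y => bump a y * cos y) 0 (2 * PI)); split; [|exact HI].
  apply (RInt_correct (V := R_CompleteNormedModule)), ex_RInt_bump_cos. }
clear HI; destruct HI' as [I [HI HI0]].
(* The mean of [bump a y * cos y] is 2c, so a uniform error of at most [c] still leaves [c]. *)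
exists (I / (4 * PI)); assert (Hc : 0 < I / (4 * PI)) by (apply Rdiv_lt_0_compat; lra).
set (c := I / (4 * PI)) in *; assert (HcI : I = 4 * PI * c) by (unfold c; field; lra).
split; [exact Hc|]; intros eta He.
destruct (wiener_split _ _ (Rmin eta c) (Rmin_pos _ _ He Hc) (wiener_bump a)) as [p [Hp1 Hp2]].
(* Averaging with the reflection preserves the approximation, as the bump is even, and makes the
   coefficients at 1 and -1 exactly equal. *)
set (q := smon 0 (RtoC (1/2)) (p ++ dil (-1) p)); exists q.
assert (Hhalf : Cmod (RtoC (1/2)) = 1/2) by (rewrite Cmod_R; apply Rabs_pos_eq; lra).
assert (Hwn : wiener (fun y => RtoC (bump a y) - eval q y)%C (Rmin eta c)).
{ apply wiener_le with (Cmod (RtoC (1/2)) * (Rmin eta c + Rmin eta c)); [rewrite Hhalf; lra|].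
  apply wiener_ext with (2 := wiener_scal (RtoC (1/2)) _ _ (wiener_plus _ _ _ _ Hp2 (wiener_dil (-1) _ _ Hp2))).
  intros y; cbv beta; unfold q; rewrite eval_smon, eval_app, eval_dil, Rmult_0_l, E_0.
  replace (bump a (-1 * y)) with (bump a y) by (rewrite <- bump_even; f_equal; ring).
  transitivity ((RtoC (1/2) + RtoC (1/2)) * bump a y - RtoC (1/2) * (eval p y + eval p (-1 * y)))%C; [ring|].
  rewrite <- RtoC_plus; replace (1/2 + 1/2) with 1 by field; ring. }
assert (Hre : forall y, bump a y - c <= Re (eval q y)).
{ intros y; assert (H := wiener_sup _ _ y Hwn).
  assert (H' := re_le_Cmod (RtoC (bump a y) - eval q y)%C).
  assert (Hm := Rmin_r eta c); apply Rabs_le_between in H'.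
  cbv beta in H; unfold Cminus in *; rewrite re_plus, re_opp, re_RtoC in H'; lra. }
assert (Hint : forall k, RInt (fun y => k * (bump a y * cos y) - k * c) 0 (2 * PI) = k * (I - 2 * PI * c)).
{ intros k; apply is_RInt_unique.
  replace (k * (I - 2 * PI * c)) with (minus (scal k I) (scal (2 * PI - 0) (k * c))).
  2:{ unfold minus, plus, opp, scal; simpl; unfold mult; simpl; ring. }
  apply (is_RInt_minus (V := R_NormedModule)); [|apply (is_RInt_const (V := R_NormedModule))].
  apply (is_RInt_scal (V := R_NormedModule)), HI. }
assert (Hex : forall k, ex_RInt (fun y => k * (bump a y * cos y) - k * c) 0 (2 * PI)).
{ intros k; apply (ex_RInt_minus (V := R_NormedModule)); [|apply (ex_RInt_const (V := R_NormedModule))].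
  apply (ex_RInt_scal (V := R_NormedModule)), ex_RInt_bump_cos. }
assert (Hsym : coef q (-1) = coef q 1).
{ unfold q; rewrite !coef_smon, !coef_app, !coef_dil_opp; simpl; ring. }
repeat split.
- unfold q; rewrite norm1_smon, norm1_app, norm1_dil, Hhalf; lra.
- apply wiener_le with (2 := Hwn); apply Rmin_l.
- exact Hsym.
- assert (H := Re_coef_0_ge q (fun y => 1 * (bump a y * cos y) - 1 * c)).
  rewrite Hint in H; apply Rmult_le_reg_l with (2 * PI); [lra|].
  apply Rle_trans with (2 := H ltac:(intros y; generalize (Hre y) (bump_cos_bounds a y Ha); lra) (Hex 1)).
  rewrite HcI; nra.
(* [r] is 2 cos y times [q], so its mean is twice the first coefficient of [q]. *)
- set (r := smon 1 1 q ++ smon (-1) 1 q).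
  assert (Hr0 : coef r 0 = (2 * coef q 1)%C).
  { unfold r; rewrite coef_app, !coef_smon.
    change (0 - 1)%Z with (-1)%Z; change (0 - -1)%Z with 1%Z; rewrite Hsym; ring. }
  assert (Hr : forall y, Re (eval r y) = 2 * cos y * Re (eval q y)).
  { intros y; unfold r; rewrite eval_app, !eval_smon.
    replace (1 * E (IZR 1 * y) * eval q y + 1 * E (IZR (-1) * y) * eval q y)%C
      with ((E (IZR 1 * y) + E (IZR (- (1)) * y)) * eval q y)%C by (simpl; ring).
    rewrite cos_IZR_E, Rmult_1_l; unfold Re, Cmult, RtoC; simpl; ring. }
  assert (H := Re_coef_0_ge r (fun y => 2 * (bump a y * cos y) - 2 * c)).
  rewrite Hint, Hr0 in H; apply Rmult_le_reg_l with (2 * PI); [lra|].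
  assert (Hle : 2 * (I - 2 * PI * c) <= 2 * PI * Re (2 * coef q 1)%C).
  { apply H; [|apply Hex]; intros y; rewrite Hr.
    assert (H0 := wiener_sup _ _ y Hwn).
    assert (H' := re_le_Cmod (RtoC (bump a y) - eval q y)%C).
    assert (Hm := Rmin_r eta c); apply Rabs_le_between in H'.
    cbv beta in H0; unfold Cminus in *; rewrite re_plus, re_opp, re_RtoC in H'.
    assert (Hcy := COS_bound y).
    assert (Hd : - c <= Re (eval q y) - bump a y <= c) by lra.
    set (d := Re (eval q y) - bump a y) in *; replace (Re (eval q y)) with (bump a y + d) by (unfold d; ring).
    assert (- c <= cos y * d) by nra; lra. }
  replace (Re (2 * coef q 1)%C) with (2 * Re (coef q 1)) in Hle
    by (unfold Re, Cmult, RtoC; simpl; ring).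
  rewrite HcI in Hle; nra.
Qed.

(** The bump and its translates by [a] and [- a] live within 2a of the multiples of 2 PI, and 1 -
    cos (2a) = 2 sin^2 a. *)
Lemma corrector_support (a y : R) : 0 < a < PI / 2 ->
  bump a y <> 0 \/ bump a (y + a) <> 0 \/ bump a (y + - a) <> 0 ->
  0 <= 1 - cos y <= 2 * sin a ^ 2.
Proof.
intros Ha H; split; [generalize (COS_bound y); lra|].
assert (Hca : 0 < cos a) by (apply cos_gt_0; lra).
assert (Hsa : 0 < sin a) by (apply sin_gt_0; lra).
assert (Ea := sin2_cos2 a); unfold Rsqr in Ea.
assert (Hshift : forall z, bump a z <> 0 -> 1 - 2 * sin a ^ 2 <= cos z * cos a - Rabs (sin z) * sin a).
{ intros z Hz; destruct (bump_support a z Ha Hz) as [Hc Hs].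
  assert (Ez := sin2_cos2 z); unfold Rsqr in Ez.
  assert (Hcz : cos a <= cos z) by nra.
  assert (Hsz : Rabs (sin z) <= sin a) by (apply Rabs_le; split; nra).
  assert (H1 := Rabs_pos (sin z)); nra. }
destruct H as [H|[H|H]].
- destruct (bump_support a y Ha H) as [Hc Hs].
  assert (Ey := sin2_cos2 y); unfold Rsqr in Ey.
  assert (Hy := COS_bound y); nra.
- specialize (Hshift _ H); replace y with ((y + a) - a) by ring.
  rewrite cos_minus; assert (Hr := Rle_abs (- sin (y + a))); rewrite Rabs_Ropp in Hr; nra.
- specialize (Hshift _ H); replace y with ((y + - a) + a) by ring.
  rewrite cos_plus; assert (Hr := Rle_abs (sin (y + - a))); nra.
Qed.

Lemma Cmod_inv_le (b : C) (c : R) : 0 < c -> c <= Re b -> b <> 0%C /\ Cmod (/ b) <= / c.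
Proof.
intros Hc Hb; assert (H := re_le_Cmod b); assert (H' := Rle_abs (Re b)).
assert (Hb0 : b <> 0%C) by (apply Cmod_gt_0; lra).
split; [exact Hb0|rewrite Cmod_inv by exact Hb0; apply Rinv_le_contravar; lra].
Qed.

(* A second difference lam B(y) + mu (B(y + a) + B(y - a)) of the bump B has
   l-th coefficient b_l (lam + 2 mu cos (l a)), so two of them can be prescribed. *)
Lemma corrector (a : R) : 0 < a < PI / 2 -> exists K, 0 < K /\
  forall eta, 0 < eta -> exists (Q : R -> C) (q : trigpoly),
    wiener Q K /\ norm1 q <= K /\ wiener (fun y => Q y - eval q y)%C eta /\
    coef q 0 = 1%C /\ coef q 1 = RtoC (-1/2) /\ coef q (-1) = RtoC (-1/2) /\
    forall y, Q y = 0%C \/ 0 <= 1 - cos y <= 2 * sin a ^ 2.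
Proof.
intros Ha; destruct (bump_approx a Ha) as [c [Hc Happ]].
set (kap := 1 - cos a).
assert (Hkap : 0 < kap).
{ unfold kap; generalize (cos_decreasing_1 0 a); rewrite cos_0; generalize PI_RGT_0; intros; lra. }
set (W := / c + 4 * (/ c * / kap)).
assert (Hic : 0 < / c) by now apply Rinv_0_lt_compat.
assert (Hik : 0 < / kap) by now apply Rinv_0_lt_compat.
assert (HW : 0 < W) by (unfold W; nra).
exists (W * (9/4)); split; [lra|].
intros eta Heta; destruct (Happ (eta / W)) as [r [Hr1 [Hr2 [Hr3 [Hr4 Hr5]]]]].
{ now apply Rdiv_lt_0_compat. }
set (b0 := coef r 0) in *; set (b1 := coef r 1) in *.
destruct (Cmod_inv_le _ _ Hc Hr4) as [Hb0 Hi0]; destruct (Cmod_inv_le _ _ Hc Hr5) as [Hb1 Hi1].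
(* Solution of lam + 2 mu = 1 / b0 and lam + 2 mu cos a = - 1 / (2 b1). Since [b0] and [b1] belong
   to the approximation [r], the prescribed coefficients of [q] are exact; the bounds on [lam] and
   [mu] involve only [c] and [kap], hence not [eta]. *)
set (mu := (RtoC (/ kap) * (RtoC (1/2) * / b0 + RtoC (1/4) * / b1))%C).
set (lam := (/ b0 - 2 * mu)%C).
assert (Hmu : Cmod mu <= / c * / kap).
{ unfold mu; rewrite Cmod_mult, Cmod_R, Rabs_pos_eq by lra.
  rewrite Rmult_comm; apply Rmult_le_compat_r; [lra|].
  eapply Rle_trans; [apply Cmod_triangle|].
  rewrite !Cmod_mult, !Cmod_R, !Rabs_pos_eq by lra; lra. }
assert (Hlam : Cmod lam <= / c + 2 * (/ c * / kap)).
{ unfold lam, Cminus; eapply Rle_trans; [apply Cmod_triangle|].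
  rewrite Cmod_opp, Cmod_mult, Cmod_R, Rabs_pos_eq by lra; lra. }
set (comb := fun F : R -> C => fun y => (lam * F y + mu * (F (y + a)%R + F (y + - a)%R))%C).
assert (Hcomb : forall F e, wiener F e -> wiener (comb F) (W * e)).
{ intros F e HF; assert (He := wiener_nonneg _ _ HF).
  apply wiener_le with (2 := wiener_plus _ _ _ _ (wiener_scal lam _ _ HF)
     (wiener_scal mu _ _ (wiener_plus _ _ _ _ (wiener_rot a _ _ HF) (wiener_rot (- a) _ _ HF)))).
  unfold W; assert (Cmod lam * e <= (/ c + 2 * (/ c * / kap)) * e) by now apply Rmult_le_compat_r.
  assert (Cmod mu * (e + e) <= / c * / kap * (e + e)) by (apply Rmult_le_compat_r; lra).
  lra. }
set (q := smon 0 lam r ++ smon 0 mu (rot a r ++ rot (- a) r)).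
exists (comb (fun y => RtoC (bump a y))), q.
assert (Hq : forall y, eval q y = comb (eval r) y).
{ intros y; unfold q, comb; rewrite eval_app, !eval_smon, eval_app, !eval_rot, Rmult_0_l, E_0; ring. }
assert (Hcoef : forall l, coef q l = (coef r l * (lam + mu * RtoC (2 * cos (IZR l * a))))%C).
{ intros l; unfold q; rewrite coef_app, !coef_smon, coef_app, !coef_rot, Z.sub_0_r.
  rewrite <- cos_IZR_E, opp_IZR.
  replace (- IZR l * a) with (IZR l * - a) by ring; ring. }
assert (H1 : (b1 * (lam + mu * RtoC (2 * cos a)))%C = RtoC (-1/2)).
{ replace (cos a) with (1 - kap) by (unfold kap; ring).
  rewrite (RtoC_mult 2), (RtoC_minus 1); unfold lam.
  transitivity (b1 * / b0 - 2 * b1 * (mu * kap))%C; [ring|].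
  assert (Hk : (RtoC kap * RtoC (/ kap) = 1)%C) by (rewrite <- RtoC_mult; f_equal; field; lra).
  unfold mu; transitivity (b1 * / b0 * (1 - (2 * RtoC (1/2)) * (kap * RtoC (/ kap)))
    - (2 * RtoC (1/4)) * (b1 * / b1) * (kap * RtoC (/ kap)))%C; [ring|].
  assert (H2 : (2 * RtoC (1/2) = 1)%C) by (rewrite <- RtoC_mult; f_equal; field).
  assert (H4 : (2 * RtoC (1/4) = - RtoC (-1/2))%C) by (rewrite <- RtoC_mult, <- RtoC_opp; f_equal; field).
  rewrite Hk, Cinv_r, H2, H4 by exact Hb1; ring. }
repeat split.
- apply Hcomb, wiener_bump.
- unfold q; rewrite norm1_app, !norm1_smon, norm1_app, !norm1_rot.
  assert (0 <= norm1 r) by apply norm1_ge_0; unfold W.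
  assert (Cmod lam * norm1 r <= (/ c + 2 * (/ c * / kap)) * norm1 r) by (apply Rmult_le_compat_r; lra).
  assert (Cmod mu * (norm1 r + norm1 r) <= / c * / kap * (norm1 r + norm1 r)) by (apply Rmult_le_compat_r; lra).
  assert (0 < / c * / kap) by nra.
  assert ((/ c + 4 * (/ c * / kap)) * norm1 r <= (/ c + 4 * (/ c * / kap)) * (9/4)) by (apply Rmult_le_compat_l; lra).
  lra.
- apply wiener_le with (W * (eta / W)); [right; field; lra|].
  apply wiener_ext with (2 := Hcomb _ _ Hr2); intros y; rewrite Hq; unfold comb; ring.
- rewrite Hcoef, Rmult_0_l, cos_0, Rmult_1_r; fold b0; unfold lam.
  transitivity (b0 * / b0)%C; [ring|now apply Cinv_r].
- rewrite Hcoef, Rmult_1_l; exact H1.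
- rewrite Hcoef, Hr3; replace (-1 * a) with (- a) by ring; rewrite cos_neg; exact H1.
- intros y; unfold comb.
  destruct (Req_dec (bump a y) 0) as [E1|E1]; [|right; apply corrector_support; auto].
  destruct (Req_dec (bump a (y + a)) 0) as [E2|E2]; [|right; apply corrector_support; auto].
  destruct (Req_dec (bump a (y + - a)) 0) as [E3|E3]; [|right; apply corrector_support; auto].
  left; rewrite E1, E2, E3; ring.
Qed.

(** * Switches following the sign of the sine *)

(* The ratio 5 is large enough for the frequencies of the product not to collide (so that
   all coefficients are at most 2^-p), and odd, so that sin s divides sin (5 s). *)
Fixpoint cosprod (p : nat) (s : R) : R :=
  match p with O => 1 | S p => cos s ^ 2 * cosprod p (5 * s) end.

Fixpoint cosprod_tp (p : nat) : trigpoly :=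
  match p with O => [(0%Z, RtoC 1)] | S p => blk (fun _ => cossq) 5 (cosprod_tp p) end.

Lemma eval_one (x : R) : eval [(0%Z, RtoC 1)] x = 1%C.
Proof. unfold eval; simpl; rewrite Rmult_0_l, E_0; ring. Qed.

Lemma eval_cosprod_tp (p : nat) (s : R) : eval (cosprod_tp p) s = RtoC (cosprod p s).
Proof.
revert s; induction p as [|p IH]; intros s; [apply eval_one|].
simpl cosprod_tp; rewrite eval_blk_const, eval_cossq, IH, <- RtoC_mult; reflexivity.
Qed.

Lemma cosprod_bounds (p : nat) (s : R) : 0 <= cosprod p s <= 1.
Proof.
revert s; induction p as [|p IH]; intros s; simpl; [lra|].
specialize (IH (5 * s)); assert (H := COS_bound s); split; [nra|].
assert (0 <= cos s * (cos s * 1) <= 1) by (split; nra); nra.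
Qed.

Lemma degle_cossq : degle 2 cossq.
Proof. intros e He; simpl in He; repeat (destruct He as [<-|He]; [simpl; lia|]); easy. Qed.

Lemma coef_cossq (l : Z) : Cmod (coef cossq l) <= 1/2 /\ coef cossq 0 = RtoC (1/2).
Proof.
split; [|unfold coef, cossq; simpl; ring].
unfold coef, cossq, lsum; cbn [fold_right fst snd].
repeat destruct Z.eq_dec; try lia;
  rewrite ?Cplus_0_l, ?Cplus_0_r, ?Cmod_0, ?Cmod_R, ?Rabs_pos_eq by lra; lra.
Qed.

Lemma coef_cosprod_tp (p : nat) (l : Z) : Cmod (coef (cosprod_tp p) l) <= (1/2) ^ p /\ coef (cosprod_tp p) 0 = RtoC ((1/2) ^ p).
Proof.
revert l; induction p as [|p IH]; intros l.
- split; unfold coef, lsum; cbn [cosprod_tp fold_right fst snd pow]; [|now rewrite Cplus_0_r].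
  destruct Z.eq_dec; rewrite ?Cplus_0_r, ?Cmod_0, ?Cmod_1; lra.
- simpl cosprod_tp; split.
  + rewrite (coef_blk _ _ _ 2) by (try lia; intros; apply degle_cossq).
    rewrite Cmod_mult, Rmult_comm; simpl; apply Rmult_le_compat; try apply Cmod_ge_0.
    * apply coef_cossq.
    * apply IH.
  + rewrite (coef_blk _ _ _ 2) by (try lia; intros; apply degle_cossq).
    change ((0 + 2) / 5)%Z with 0%Z; change (0 - 5 * 0)%Z with 0%Z.
    rewrite (proj2 (IH 0%Z)), (proj2 (coef_cossq 0)), <- RtoC_mult; f_equal; simpl; ring.
Qed.

(** The Dirichlet kernel sin (5 s) / sin s. *)
Definition dirichlet2 : trigpoly := [(0%Z, RtoC 1); (2%Z, RtoC 1); ((-2)%Z, RtoC 1); (4%Z, RtoC 1); ((-4)%Z, RtoC 1)].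

Lemma eval_dirichlet2 (s : R) : eval dirichlet2 s = RtoC (1 + 2 * cos (2 * s) + 2 * cos (4 * s)).
Proof.
rewrite !RtoC_plus; assert (H2 := cos_IZR_E 2 s); assert (H4 := cos_IZR_E 4 s).
change (- (2))%Z with (-2)%Z in H2; change (- (4))%Z with (-4)%Z in H4.
rewrite <- H2, <- H4; unfold eval, dirichlet2, lsum; cbn [fold_right fst snd].
rewrite Rmult_0_l, E_0; ring.
Qed.

Lemma sin_5a (s : R) : sin (5 * s) = sin s * (1 + 2 * cos (2 * s) + 2 * cos (4 * s)).
Proof.
replace (5 * s) with (2 * (2 * s) + s) by ring; replace (4 * s) with (2 * (2 * s)) by ring.
rewrite sin_plus, (sin_2a (2 * s)), (cos_2a_cos (2 * s)), (sin_2a s).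
assert (H := cos_2a_cos s); set (d := cos (2 * s)) in *; set (c := cos s) in *.
replace (2 * (2 * sin s * c) * d * c) with (2 * sin s * d * (2 * c * c)) by ring.
replace (2 * c * c) with (d + 1) by lra; ring.
Qed.

(** The quotient of [1 - cosprod p s] by sin^2 s. The recursion comes from 1 - cos^2 s R = sin^2 s +
    cos^2 s (1 - R), where R is the product at 5s and sin s divides sin (5 s). *)
Fixpoint cofact (p : nat) (s : R) : R :=
  match p with
  | O => 0
  | S p => 1 + cos s ^ 2 * (1 + 2 * cos (2 * s) + 2 * cos (4 * s)) ^ 2 * cofact p (5 * s)
  end.

Fixpoint cofact_tp (p : nat) : trigpoly :=
  match p with
  | O => []
  | S p => (0%Z, RtoC 1) :: blk (fun _ => mul cossq (mul dirichlet2 dirichlet2)) 5 (cofact_tp p)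
  end.

Lemma eval_cofact_tp (p : nat) (s : R) : eval (cofact_tp p) s = RtoC (cofact p s).
Proof.
revert s; induction p as [|p IH]; intros s; [easy|].
change (cofact_tp (S p)) with ([(0%Z, RtoC 1)] ++ blk (fun _ => mul cossq (mul dirichlet2 dirichlet2)) 5 (cofact_tp p)).
rewrite eval_app, eval_one, eval_blk_const, !eval_mul, eval_cossq, eval_dirichlet2, IH.
rewrite <- !RtoC_mult, <- RtoC_plus; f_equal; simpl; ring.
Qed.

Lemma cofact_even (p : nat) (s : R) : cofact p (- s) = cofact p s.
Proof.
revert s; induction p as [|p IH]; intros s; simpl; [easy|].
replace (5 * - s) with (- (5 * s)) by ring; replace (2 * - s) with (- (2 * s)) by ring.
replace (4 * - s) with (- (4 * s)) by ring; now rewrite !cos_neg, IH.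
Qed.

Lemma one_minus_cosprod (p : nat) (s : R) : 1 - cosprod p s = sin s ^ 2 * cofact p s.
Proof.
revert s; induction p as [|p IH]; intros s; simpl; [ring|].
specialize (IH (5 * s)); rewrite sin_5a in IH.
assert (H := sin2_cos2 s); unfold Rsqr in H.
set (V := 1 + 2 * cos (2 * s) + 2 * cos (4 * s)) in *.
transitivity (sin s * sin s + cos s * cos s * (1 - cosprod p (5 * s))); [|rewrite IH; ring].
replace (sin s * sin s) with (1 - cos s * cos s) by lra; ring.
Qed.

(* (1 - cosprod p) multiplied by the sign of the sine. *)
Definition signed_gap (p : nat) (s : R) : R := sin s * Rabs (sin s) * cofact p s.

(** The first switch: [1 - cosprod p s] where the sine is nonnegative, 0 elsewhere; [gap_neg] is the
    opposite one. The factor sin^2 s inside removes the jump of the sign. *)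
Definition gap_pos (p : nat) (s : R) : R := (1 - cosprod p s + signed_gap p s) / 2.

Definition gap_neg (p : nat) (s : R) : R := (1 - cosprod p s - signed_gap p s) / 2.

Lemma signed_gap_cases (p : nat) (s : R) : signed_gap p s = 1 - cosprod p s \/ signed_gap p s = - (1 - cosprod p s).
Proof.
rewrite one_minus_cosprod; unfold signed_gap, Rabs; destruct Rcase_abs; [right|left]; ring.
Qed.

Lemma gap_pos_neg (p : nat) (s : R) :
  0 <= gap_pos p s <= 1 /\ 0 <= gap_neg p s <= 1 /\ (gap_pos p s = 0 \/ gap_neg p s = 0).
Proof.
unfold gap_pos, gap_neg; assert (H := cosprod_bounds p s).
destruct (signed_gap_cases p s) as [-> | ->]; repeat split; lra.
Qed.

Lemma signed_gap_odd (p : nat) (s : R) : signed_gap p (- s) = - signed_gap p s.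
Proof. unfold signed_gap; rewrite sin_neg, Rabs_Ropp, cofact_even; ring. Qed.

Lemma signed_gap_bound (p : nat) (s : R) : Rabs (signed_gap p s) <= 1.
Proof.
assert (H := cosprod_bounds p s); apply Rabs_le; destruct (signed_gap_cases p s) as [-> | ->]; lra.
Qed.

Lemma wiener_signed_gap (p : nat) : wiener (fun s => RtoC (signed_gap p s)) (2 * norm1 (cofact_tp p)).
Proof.
assert (Hs := wiener_eval sint); rewrite norm1_sint in Hs.
apply wiener_le with (1 * 2 * norm1 (cofact_tp p)); [lra|].
apply wiener_ext with (2 := wiener_mult _ _ _ _ (wiener_mult _ _ _ _ Hs wiener_abs_sin) (wiener_eval (cofact_tp p))).
intros s; rewrite eval_sint, eval_cofact_tp, <- !RtoC_mult; reflexivity.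
Qed.

Definition gap_tp (p : nat) : trigpoly := (0%Z, RtoC 1) :: smon 0 (- (1))%C (cosprod_tp p).

Lemma eval_gap_tp (p : nat) (s : R) : eval (gap_tp p) s = RtoC (1 - cosprod p s).
Proof.
unfold gap_tp; change (?e :: ?r) with ([e] ++ r); rewrite eval_app, eval_one, eval_smon, eval_cosprod_tp.
rewrite Rmult_0_l, E_0, RtoC_minus; ring.
Qed.

Lemma coef_gap_tp (p : nat) (l : Z) :
  coef (gap_tp p) 0 = RtoC (1 - (1/2) ^ p) /\ (l <> 0%Z -> Cmod (coef (gap_tp p) l) <= (1/2) ^ p).
Proof.
assert (H : coef (gap_tp p) l = ((if Z.eq_dec 0 l then 1 else 0) - coef (cosprod_tp p) l)%C /\
  coef (gap_tp p) 0 = (1 - coef (cosprod_tp p) 0)%C).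
{ unfold gap_tp; split; change (?e :: ?r) with ([e] ++ r); rewrite coef_app, coef_smon, Z.sub_0_r;
    unfold coef at 1; simpl; ring. }
destruct H as [H1 H2]; split.
- now rewrite H2, (proj2 (coef_cosprod_tp p 0)), <- RtoC_minus.
- intros Hl; rewrite H1; destruct Z.eq_dec; [lia|].
  replace (0 - coef (cosprod_tp p) l)%C with (- coef (cosprod_tp p) l)%C by ring.
  rewrite Cmod_opp; apply coef_cosprod_tp.
Qed.

(** * The flat kernel *)

(* F composed with a phase which starts at th and, at each of i scales, is increased by t s
   with weight a, or kept with weight b. *)
Fixpoint comp (a b : R -> C) (t L : Z) (F : R -> C) (i : nat) (th s : R) : C :=
  match i with
  | O => F th
  | S i => (a s * comp a b t L F i (th + IZR t * s)%R (IZR L * s)%R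
            + b s * comp a b t L F i th (IZR L * s)%R)%C
  end.

Lemma wiener_comp (a b F : R -> C) (t L : Z) (V K : R) :
  wiener a (V / 2) -> wiener b (V / 2) -> wiener F K ->
  forall i m n, wiener (fun x => comp a b t L F i (IZR m * x) (IZR n * x)) (V ^ i * K).
Proof.
intros Ha Hb HF; induction i as [|i IH]; intros m n.
- simpl; rewrite Rmult_1_l; now apply wiener_dil.
- assert (H1 := wiener_mult _ _ _ _ (wiener_dil n _ _ Ha) (IH (m + t * n)%Z (L * n)%Z)).
  assert (H2 := wiener_mult _ _ _ _ (wiener_dil n _ _ Hb) (IH m (L * n)%Z)).
  apply wiener_le with (V / 2 * (V ^ i * K) + V / 2 * (V ^ i * K)); [simpl; lra|].
  apply wiener_ext with (2 := wiener_plus _ _ _ _ H1 H2); intros x; simpl.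
  rewrite plus_IZR, !mult_IZR, Rmult_plus_distr_r, !Rmult_assoc; reflexivity.
Qed.

(** One factor is replaced at a time: a X - a' X' = (a - a') X + a' (X - X'). Each of the [i]
    scales, and the innermost function, costs at most [V ^ i * K * eta]. *)
Lemma wiener_comp_diff (a b a' b' F F' : R -> C) (t L : Z) (V K eta : R) :
  1 <= V -> 1 <= K ->
  wiener a (V / 2) -> wiener b (V / 2) -> wiener a' (V / 2) -> wiener b' (V / 2) -> wiener F K ->
  wiener (fun s => a s - a' s)%C (eta / 2) -> wiener (fun s => b s - b' s)%C (eta / 2) ->
  wiener (fun s => F s - F' s)%C eta ->
  forall i m n,
  wiener (fun x => comp a b t L F i (IZR m * x) (IZR n * x) -
               comp a' b' t L F' i (IZR m * x) (IZR n * x))%C ((INR i + 1) * V ^ i * K * eta).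
Proof.
intros HV HK Ha Hb Ha' Hb' HF Hda Hdb HdF; assert (He := wiener_nonneg _ _ HdF).
induction i as [|i IH]; intros m n.
- simpl; apply wiener_le with eta; [nra|].
  exact (wiener_dil m _ _ HdF).
- assert (H1 := wiener_mult _ _ _ _ (wiener_dil n _ _ Hda)
    (wiener_comp _ _ _ t L _ _ Ha Hb HF i (m + t * n)%Z (L * n)%Z)).
  assert (H2 := wiener_mult _ _ _ _ (wiener_dil n _ _ Hdb)
    (wiener_comp _ _ _ t L _ _ Ha Hb HF i m (L * n)%Z)).
  assert (H3 := wiener_mult _ _ _ _ (wiener_dil n _ _ Ha') (IH (m + t * n)%Z (L * n)%Z)).
  assert (H4 := wiener_mult _ _ _ _ (wiener_dil n _ _ Hb') (IH m (L * n)%Z)).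
  apply wiener_trans with (1 := (wiener_plus _ _ _ _ (wiener_plus _ _ _ _ H1 H2) (wiener_plus _ _ _ _ H3 H4))).
  + rewrite S_INR; simpl; assert (HVi : 1 <= V ^ i) by now apply pow_R1_Rle.
    set (P := V ^ i) in *.
    assert (HPK : 0 <= P * K * eta) by (apply Rmult_le_pos; nra).
    assert (Hi := pos_INR i); nra.
  + intros x; simpl.
    rewrite plus_IZR, !mult_IZR, Rmult_plus_distr_r, !Rmult_assoc; ring.
Qed.

(* At each point the phases can be followed down to a single argument. *)
Lemma comp_single (a b : R -> R) (t L : Z) :
  (forall s, 0 <= a s <= 1 /\ 0 <= b s <= 1 /\ (a s = 0 \/ b s = 0)) ->
  forall i th s, exists w phi, 0 <= w <= 1 /\
    forall F, comp (fun s => RtoC (a s)) (fun s => RtoC (b s)) t L F i th s = (RtoC w * F phi)%C.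
Proof.
intros H; induction i as [|i IH]; intros th s.
- exists 1, th; split; [lra|]; intros F; simpl; ring.
- destruct (H s) as [Ha [Hb [H0|H0]]].
  + destruct (IH th (IZR L * s)) as [w [phi [Hw HF]]].
    exists (b s * w), phi; split; [split; nra|]; intros F; simpl.
    rewrite H0, (HF F), RtoC_mult; ring.
  + destruct (IH (th + IZR t * s) (IZR L * s)) as [w [phi [Hw HF]]].
    exists (a s * w), phi; split; [split; nra|]; intros F; simpl.
    rewrite H0, (HF F), RtoC_mult; ring.
Qed.

(** The multiplier of mode [j]: when F is the mode e^{ij.}, the composition equals e^{ij th} times
    this polynomial in s, because moving the phase by t s multiplies the mode by e^{ijts}. *)
Fixpoint Psi (al bl : trigpoly) (t L : Z) (i : nat) (j : Z) : trigpoly :=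
  match i with
  | O => [(0%Z, RtoC 1)]
  | S i => blk (fun _ => smon (j * t) 1 al ++ bl) L (Psi al bl t L i j)
  end.

Lemma comp_eval (al bl q : trigpoly) (t L : Z) (i : nat) (th s : R) :
  comp (eval al) (eval bl) t L (eval q) i th s =
  lsum (fun e => snd e * E (IZR (fst e) * th) * eval (Psi al bl t L i (fst e)) s)%C q.
Proof.
revert th s; induction i as [|i IH]; intros th s.
- cbn [comp Psi]; unfold eval at 1; apply lsum_ext; intros e _.
  rewrite eval_one; ring.
- cbn [comp Psi]; rewrite !IH, <- !lsum_scal.
  assert (Hadd : forall g h p, (lsum g p + lsum h p)%C = lsum (fun e => g e + h e)%C p).
  { intros g h p; induction p as [|e p IHp]; simpl; [ring|rewrite <- IHp; ring]. }
  rewrite Hadd; apply lsum_ext; intros e _.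
  rewrite eval_blk_const, eval_app, eval_smon, Rmult_plus_distr_l, E_plus, mult_IZR.
  replace (IZR (fst e) * IZR t * s) with (IZR (fst e) * (IZR t * s)) by ring; ring.
Qed.

Lemma norm1_Psi (al bl : trigpoly) (t L : Z) (i : nat) (j : Z) (V : R) :
  norm1 al <= V / 2 -> norm1 bl <= V / 2 -> norm1 (Psi al bl t L i j) <= V ^ i.
Proof.
intros Ha Hb; induction i as [|i IH].
- simpl; rewrite Cmod_1; lra.
- simpl; eapply Rle_trans.
  + apply norm1_blk with (b := V); intros e _.
    rewrite norm1_app, norm1_smon, Cmod_1; lra.
  + rewrite Rmult_comm; apply Rmult_le_compat_l; [|exact IH].
    generalize (norm1_ge_0 al); lra.
Qed.

Lemma degle_Psi (al bl : trigpoly) (t L D0 J : Z) :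
  degle D0 al -> degle D0 bl -> (0 <= D0)%Z -> (0 <= J)%Z ->
  forall i, exists D, (0 <= D)%Z /\
    forall j, (Z.abs j <= J)%Z -> degle D (Psi al bl t L i j).
Proof.
intros Ha Hb HD0 HJ; induction i as [|i [D [HD IH]]].
- exists 0%Z; split; [lia|]; intros j _ e [<-|[]]; simpl; lia.
- exists (D0 + J * Z.abs t + Z.abs L * D)%Z; split; [nia|].
  intros j Hj; simpl; apply degle_blk; [|now apply IH].
  intros e _; apply degle_app; [|apply (degle_le D0); [nia|exact Hb]].
  apply (degle_le (D0 + Z.abs (j * t))); [nia|]; now apply degle_smon.
Qed.

(** For j <> 0 the shift by [j * t] exceeds 2 [D0] and separates the spectrum of [al] from that of
    [bl], while [L] separates the scales. So each coefficient is a single product, with one factor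
    per scale. *)
Lemma coef_Psi_le (al bl : trigpoly) (t L D0 J : Z) (rho : R) :
  degle D0 al -> degle D0 bl -> (0 <= D0)%Z -> (2 * D0 < t)%Z ->
  (2 * (D0 + J * t) < L)%Z ->
  (forall l, Cmod (coef al l) <= rho) -> (forall l, Cmod (coef bl l) <= rho) ->
  forall i j l, (Z.abs j <= J)%Z -> j <> 0%Z ->
  Cmod (coef (Psi al bl t L i j) l) <= rho ^ i.
Proof.
intros Hda Hdb HD0 Ht HL Ha Hb i j l Hj Hj0; revert l.
assert (Hd : degle (D0 + J * t) (smon (j * t) 1 al ++ bl)).
{ apply degle_app; [|apply (degle_le D0); [nia|exact Hdb]].
  apply (degle_le (D0 + Z.abs (j * t))); [nia|]; now apply degle_smon. }
induction i as [|i IH]; intros l.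
- unfold coef, lsum; cbn [Psi fold_right fst snd pow].
  destruct Z.eq_dec; rewrite ?Cplus_0_r, ?Cmod_0, ?Cmod_1; lra.
- cbn [Psi]; rewrite (coef_blk _ _ _ (D0 + J * t)) by (auto; nia).
  rewrite Cmod_mult, Rmult_comm; simpl; apply Rmult_le_compat; try apply Cmod_ge_0; [|apply IH].
  set (k := (l - _)%Z); rewrite coef_app, coef_smon, Cmult_1_l.
  destruct (Z_lt_le_dec D0 (Z.abs k)) as [Hk|Hk].
  + now rewrite (coef_out D0 bl k), Cplus_0_r.
  + rewrite (coef_out D0 al), Cplus_0_l; auto; nia.
Qed.

(** At j = 0 there is no shift, so each scale contributes [al] + [bl]. A nonzero frequency has a
    nonzero component at some scale; that scale gives a factor at most [delta], and the other
    factors are at most 1. *)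
Lemma coef_Psi_0 (al bl : trigpoly) (t L D0 : Z) (delta : R) :
  degle D0 al -> degle D0 bl -> (0 <= D0)%Z -> (2 * D0 < L)%Z -> 0 <= delta <= 1 ->
  (coef al 0 + coef bl 0 = RtoC (1 - delta))%C ->
  (forall l, l <> 0%Z -> Cmod (coef al l + coef bl l) <= delta) ->
  forall i, coef (Psi al bl t L i 0) 0 = RtoC ((1 - delta) ^ i) /\
    forall l, l <> 0%Z -> Cmod (coef (Psi al bl t L i 0) l) <= delta.
Proof.
intros Hda Hdb HD0 HL Hdel H0 Hl.
assert (Hd : degle D0 (smon (0 * t) 1 al ++ bl)).
{ apply degle_app; [|exact Hdb].
  apply (degle_le (D0 + Z.abs (0 * t))); [nia|]; now apply degle_smon. }
assert (Hc : forall l, coef (smon (0 * t) 1 al ++ bl) l = (coef al l + coef bl l)%C).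
{ intros l; rewrite coef_app, coef_smon; replace (l - 0 * t)%Z with l by ring; ring. }
assert (Hc1 : forall k, Cmod (coef al k + coef bl k) <= 1).
{ intros k; destruct (Z.eq_dec k 0) as [->|Hk]; [rewrite H0, Cmod_R, Rabs_pos_eq; lra|].
  specialize (Hl k Hk); lra. }
induction i as [|i [IH0 IH]].
- split; [unfold coef, lsum; cbn [Psi fold_right fst snd pow]; apply Cplus_0_r|].
  intros l Hl0; unfold coef, lsum; cbn [Psi fold_right fst snd].
  destruct Z.eq_dec; [lia|]; rewrite Cplus_0_r, Cmod_0; lra.
- cbn [Psi]; split.
  + rewrite (coef_blk _ _ _ D0) by (auto; lia).
    rewrite (Zdiv_small (0 + D0) L) by lia; rewrite Z.mul_0_r, Z.sub_0_r, IH0, Hc, H0, <- RtoC_mult.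
    f_equal; simpl; ring.
  + intros l Hl0; rewrite (coef_blk _ _ _ D0), Hc, Cmod_mult by (auto; lia).
    set (j := ((l + D0) / L)%Z).
    destruct (Z.eq_dec j 0) as [Hj|Hj].
    * rewrite Hj in *; rewrite IH0, Cmod_R.
      assert (Hp : 0 <= (1 - delta) ^ i <= 1).
      { split; [apply pow_le; lra|generalize (pow_incr (1 - delta) 1 i); rewrite pow1; lra]. }
      rewrite Rabs_pos_eq by lra.
      apply Rle_trans with (1 * delta); [|lra].
      apply Rmult_le_compat; [lra|apply Cmod_ge_0|lra|apply Hl; lia].
    * apply Rle_trans with (delta * 1); [|lra].
      apply Rmult_le_compat; auto using Cmod_ge_0.
Qed.

Lemma eval_cut_1 (q : trigpoly) (y : R) :
  eval (cut 1 q) y = (coef q 0 + coef q 1 * E y + coef q (-1) * E (- y))%C.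
Proof.
induction q as [|e q IH]; [unfold eval, coef; simpl; ring|].
change (coef (e :: q)) with (coef ([e] ++ q)); rewrite !coef_app.
change (e :: q) with ([e] ++ q); rewrite cut_app, eval_app, IH.
destruct e as [l c]; unfold cut, eval, coef, lsum; cbn [filter fold_right fst snd].
destruct (Z.leb_spec (Z.abs l) 1) as [H|H]; cbn [fold_right fst snd].
- assert (Hl : l = 0%Z \/ l = 1%Z \/ l = (-1)%Z) by lia.
  destruct Hl as [-> | [-> | ->]]; simpl;
    rewrite ?Rmult_0_l, ?E_0, ?Rmult_1_l; try replace (-1 * y) with (- y) by ring; ring.
- repeat (destruct Z.eq_dec; try lia); ring.
Qed.

Lemma cut_smon_0 (m : Z) (c : C) (p : trigpoly) : cut m (smon 0 c p) = smon 0 c (cut m p).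
Proof.
induction p as [|e p IH]; [easy|]; simpl; rewrite Z.add_0_r.
destruct (Z.abs (fst e) <=? m)%Z; simpl; now rewrite IH, ?Z.add_0_r.
Qed.

Lemma pow_lt_eps (r K eps : R) : 0 < r < 1 -> 0 < eps -> exists n, K * r ^ n <= eps.
Proof.
intros Hr He; destruct (Rle_lt_dec K 0) as [HK|HK].
- exists 0%nat; simpl; lra.
- destruct (pow_lt_1_zero r) with (y := eps / K) as [n Hn].
  + rewrite Rabs_pos_eq; lra.
  + now apply Rdiv_lt_0_compat.
  + exists n; specialize (Hn n (le_n n)).
    rewrite Rabs_pos_eq in Hn by (apply pow_le; lra).
    apply (Rmult_lt_compat_l K) in Hn; [|exact HK].
    replace (K * (eps / K)) with eps in Hn by (field; lra); lra.
Qed.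

Lemma one_minus_pow_ge (delta : R) (d : nat) : 0 <= delta <= 1 -> 1 - INR d * delta <= (1 - delta) ^ d.
Proof.
intros H; induction d as [|d IH]; [simpl; lra|].
rewrite S_INR; simpl.
assert (Hd := pos_INR d); assert (0 <= INR d * delta * delta) by (apply Rmult_le_pos; nra); nra.
Qed.

(* B does not depend on eta: the accuracy eta is chosen when the degree and the norm of the
   polynomial to be multiplied by P are already known, and these depend on B. *)
Definition kernel (eps B : R) : Prop :=
  forall eta, 0 < eta -> exists (G : R -> C) (P : trigpoly) (m : Z),
    (1 <= m)%Z /\ wiener G B /\ norm1 P <= B /\ wiener (fun x => G x - eval P x)%C eta /\
    coef P 0 = 1%C /\ (forall l, l <> 0%Z -> Cmod (coef P l) <= eps) /\
    forall x, Cmod (eval (cut m P) x) <= 5 /\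
      (G x = 0%C \/ Cmod (eval (cut m P) x) <= eps).

(** [al] and [bl] are half the sum and half the difference of [gap_tp p] and an approximation [sl]
    of the signed gap, so [sl] cancels exactly in their sum. The bound 3/4 is half of 3/2, which
    dominates 1/4 + 5/4 away from frequency 0 and 1 + 1/4 at 0. *)
Lemma gap_pos_neg_approx (p : nat) (eta : R) : (1/2) ^ p <= 1/4 -> 0 < eta <= 1/4 ->
  let V := 1 + norm1 (gap_tp p) + 2 * norm1 (cofact_tp p) in
  exists al bl, norm1 al <= V / 2 /\ norm1 bl <= V / 2 /\
    wiener (fun s => RtoC (gap_pos p s)) (V / 2) /\ wiener (fun s => RtoC (gap_neg p s)) (V / 2) /\
    wiener (fun s => RtoC (gap_pos p s) - eval al s)%C (eta / 2) /\
    wiener (fun s => RtoC (gap_neg p s) - eval bl s)%C (eta / 2) /\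
    (forall l, coef al l + coef bl l = coef (gap_tp p) l)%C /\
    (forall l, Cmod (coef al l) <= 3/4) /\ (forall l, Cmod (coef bl l) <= 3/4).
Proof.
intros Hp He V.
destruct (wiener_split _ _ eta (proj1 He) (wiener_signed_gap p)) as [sl [Hs1 Hs2]].
set (h := RtoC (1/2)).
assert (Hh : Cmod h = 1/2) by (unfold h; rewrite Cmod_R; apply Rabs_pos_eq; lra).
assert (Hhh : (h + h = 1)%C) by (unfold h; rewrite <- RtoC_plus; f_equal; field).
assert (Hvl : wiener (fun s => RtoC (1 - cosprod p s)) (norm1 (gap_tp p)))
  by (apply wiener_ext with (1 := eval_gap_tp p); apply wiener_eval).
assert (Hhalf : forall x, RtoC (x / 2) = (h * RtoC x)%C)
  by (intros x; unfold h; rewrite <- RtoC_mult; f_equal; field).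
assert (Hsl : forall l, Cmod (coef sl l) <= 1 + 1/4 /\ Cmod (coef sl 0) <= 1/4).
{ intros l; split.
  - apply Cmod_coef_le_sup; intros x.
    assert (H1 := wiener_sup _ _ x Hs2); cbv beta in H1.
    replace (eval sl x) with (RtoC (signed_gap p x) + - (RtoC (signed_gap p x) - eval sl x))%C by ring.
    eapply Rle_trans; [apply Cmod_triangle|]; rewrite Cmod_opp, Cmod_R.
    generalize (signed_gap_bound p x); lra.
  (* The signed gap is odd, so [sl] plus its reflection is uniformly at most 2 [eta], hence at most
     1/2. *)
  - assert (H0 : (coef (sl ++ dil (-1) sl) 0 = 2 * coef sl 0)%C)
      by (rewrite coef_app, coef_dil_opp; simpl; ring).
    assert (H1 : Cmod (coef (sl ++ dil (-1) sl) 0) <= 1/2).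
    { apply Cmod_coef_le_sup; intros x; rewrite eval_app, eval_dil.
      replace (-1 * x) with (- x) by ring.
      assert (H1 := wiener_sup _ _ x Hs2); assert (H2 := wiener_sup _ _ (- x) Hs2); cbv beta in H1, H2.
      rewrite signed_gap_odd, RtoC_opp in H2.
      replace (eval sl x + eval sl (- x))%C with
        (- (RtoC (signed_gap p x) - eval sl x) + - (- RtoC (signed_gap p x) - eval sl (- x)))%C by ring.
      eapply Rle_trans; [apply Cmod_triangle|]; rewrite !Cmod_opp; lra. }
    rewrite H0, Cmod_mult, Cmod_R, Rabs_pos_eq in H1 by lra; lra. }
assert (Hvc : forall l, Cmod (coef (gap_tp p) l) + Cmod (coef sl l) <= 3/2).
{ intros l; destruct (coef_gap_tp p l) as [Hv0 Hv]; destruct (Hsl l) as [Hl1 Hl2].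
  destruct (Z.eq_dec l 0) as [->|Hl].
  - rewrite Hv0, Cmod_R, Rabs_pos_eq by lra.
    assert (0 < (1/2) ^ p) by (apply pow_lt; lra); lra.
  - specialize (Hv Hl); lra. }
exists (smon 0 h (gap_tp p ++ sl)), (smon 0 h (gap_tp p ++ smon 0 (- (1))%C sl)).
assert (Hn := norm1_ge_0 (gap_tp p)); assert (Hn' := norm1_ge_0 (cofact_tp p)).
assert (Hm1 : Cmod (- (1))%C = 1) by (rewrite Cmod_opp; apply Cmod_1).
repeat split.
- rewrite norm1_smon, norm1_app, Hh; unfold V; lra.
- rewrite norm1_smon, norm1_app, norm1_smon, Hm1, Hh; unfold V; lra.
- apply wiener_trans with (1 := (wiener_scal h _ _ (wiener_plus _ _ _ _ Hvl (wiener_signed_gap p)))).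
  + rewrite Hh; unfold V; lra.
  + intros s; unfold gap_pos; now rewrite Hhalf, (RtoC_plus (1 - cosprod p s)).
- apply wiener_trans with (1 := (wiener_scal h _ _ (wiener_minus _ _ _ _ Hvl (wiener_signed_gap p)))).
  + rewrite Hh; unfold V; lra.
  + intros s; unfold gap_neg; now rewrite Hhalf, (RtoC_minus (1 - cosprod p s)).
- apply wiener_trans with (1 := (wiener_scal h _ _ Hs2)).
  + rewrite Hh; lra.
  + intros s; unfold gap_pos; rewrite Hhalf, (RtoC_plus (1 - cosprod p s)), eval_smon, eval_app, eval_gap_tp, Rmult_0_l, E_0; ring.
- apply wiener_trans with (1 := (wiener_scal (- h)%C _ _ Hs2)).
  + rewrite Cmod_opp, Hh; lra.
  + intros s; unfold gap_neg; rewrite Hhalf, (RtoC_minus (1 - cosprod p s)), eval_smon, eval_app, eval_smon, eval_gap_tp.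
    rewrite Rmult_0_l, E_0; ring.
- intros l; rewrite !coef_smon, !coef_app, coef_smon, !Z.sub_0_r.
  transitivity ((h + h) * coef (gap_tp p) l)%C; [ring|rewrite Hhh; ring].
- intros l; rewrite coef_smon, coef_app, Z.sub_0_r, Cmod_mult, Hh.
  specialize (Hvc l); generalize (Cmod_triangle (coef (gap_tp p) l) (coef sl l)); lra.
- intros l; rewrite coef_smon, coef_app, coef_smon, !Z.sub_0_r, Cmod_mult, Hh.
  specialize (Hvc l); generalize (Cmod_triangle (coef (gap_tp p) l) (- (1) * coef sl l)).
  rewrite Cmod_mult, Hm1; lra.
Qed.

Lemma kernel_exists (eps : R) : 0 < eps <= 1 -> exists B, 0 < B /\ kernel eps B.
Proof.
(* Then 2 sin^2 a <= eps / 8; the normalising factor, at most 2, makes this eps / 4, and eps / 2 is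
   left for the approximation error. *)
intros He; set (a := eps / 4).
assert (Ha : 0 < a < PI / 2) by (generalize PI2_1; unfold a; intros; lra).
destruct (corrector a Ha) as [K0 [HK0 Hcor]].
(* The added 2 is the l1 norm of 1 - cos y, so [K] serves for [Q], [q] and the truncation of [q]. *)
set (K := K0 + 2).
destruct (pow_lt_eps (3/4) (2 * K) eps) as [d Hd]; [lra|lra|].
assert (Hd0 := pos_INR d).
(* The three terms give delta <= 1/4, then d delta <= 1/2, which keeps the mean above 1/2 and so
   [C0] below 2, and finally 2 delta <= eps. *)
destruct (pow_lt_eps (1/2) (4 + 2 * INR d + 2 / eps) 1) as [p Hp]; [lra|lra|].
set (delta := (1/2) ^ p) in *.
assert (Hdel : 0 < delta) by (apply pow_lt; lra).
assert (Hie : 0 < 2 / eps) by (apply Rdiv_lt_0_compat; lra).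
assert (Hdel4 : delta <= 1/4) by nra.
assert (Hdeld : INR d * delta <= 1/2) by nra.
assert (Hdele : 2 * delta <= eps).
{ assert (H : 2 / eps * delta <= 1) by nra.
  apply (Rmult_le_compat_l eps) in H; [|lra].
  replace (eps * (2 / eps * delta)) with (2 * delta) in H by (field; lra); lra. }
assert (Hpow : 1/2 <= (1 - delta) ^ d) by (generalize (one_minus_pow_ge delta d); lra).
set (C0 := / (1 - delta) ^ d).
assert (HC0 : 0 < C0 <= 2).
{ unfold C0; split; [apply Rinv_0_lt_compat; lra|].
  replace 2 with (/ (1/2)) by field; apply Rinv_le_contravar; lra. }
set (V := 1 + norm1 (gap_tp p) + 2 * norm1 (cofact_tp p)).
assert (HV : 1 <= V) by (generalize (norm1_ge_0 (gap_tp p)) (norm1_ge_0 (cofact_tp p)); unfold V; lra).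
assert (HVd : 1 <= V ^ d) by now apply pow_R1_Rle.
assert (HCC : Cmod (RtoC C0) = C0) by (rewrite Cmod_R; apply Rabs_pos_eq; lra).
exists (C0 * (V ^ d * K)); split; [apply Rmult_lt_0_compat; [lra|apply Rmult_lt_0_compat; unfold K; lra]|].
intros eta Heta.
set (M := 2 * ((INR d + 1) * V ^ d * K)).
assert (HM : 0 < M) by (unfold M, K; repeat apply Rmult_lt_0_compat; lra).
set (eta1 := Rmin (1/4) (Rmin eta (eps / 2) / M)).
assert (Hm0 : 0 < Rmin eta (eps / 2)) by (apply Rmin_pos; lra).
assert (Heta1 : 0 < eta1 <= 1/4).
{ split; [apply Rmin_pos; [lra|now apply Rdiv_lt_0_compat]|apply Rmin_l]. }
assert (Herr : C0 * ((INR d + 1) * V ^ d * K * eta1) <= Rmin eta (eps / 2)).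
{ assert (H : eta1 <= Rmin eta (eps / 2) / M) by apply Rmin_r.
  apply (Rmult_le_compat_l M) in H; [|lra].
  replace (M * (Rmin eta (eps / 2) / M)) with (Rmin eta (eps / 2)) in H by (field; lra).
  apply Rle_trans with (2 := H); unfold M.
  assert (0 <= (INR d + 1) * V ^ d * K * eta1).
  { unfold K; repeat apply Rmult_le_pos; lra. }
  nra. }
destruct (Hcor eta1 (proj1 Heta1)) as [Q [q [HQ [Hq [HQq [Hq0 [Hq1 [Hqm HQs]]]]]]]].
destruct (gap_pos_neg_approx p eta1 Hdel4 Heta1)
  as [al [bl [Hal [Hbl [Wa [Wb [Da [Db [Hsum [Ca Cb]]]]]]]]]].
fold V in Hal, Hbl, Wa, Wb.
destruct (degle_ex (al ++ bl)) as [D0 [HD0 HD]].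
assert (HDa : degle D0 al) by (intros e H; apply HD, in_or_app; now left).
assert (HDb : degle D0 bl) by (intros e H; apply HD, in_or_app; now right).
destruct (degle_ex q) as [J [HJ HqJ]].
(* [t] separates the two branches, [L] the scales, and [N] below the modes of [q]. *)
set (t := (2 * D0 + 1)%Z); set (L := (2 * (D0 + J * t) + 1)%Z).
destruct (degle_Psi al bl t L D0 J HDa HDb HD0 HJ d) as [D [HDpos HDP]].
set (N := (2 * D + 1)%Z).
set (ps := Psi al bl t L d).
assert (HDq : forall e, In e q -> degle D (ps (fst e))) by (intros e Hin; apply HDP, HqJ, Hin).
set (P := smon 0 (RtoC C0) (blk ps N q)).
set (G := fun x => (RtoC C0 * comp (fun s => RtoC (gap_pos p s)) (fun s => RtoC (gap_neg p s)) t L Q d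
   (IZR N * x)%R (IZR 1 * x)%R)%C).
assert (Heval : forall r x, eval (smon 0 (RtoC C0) (blk ps N r)) x =
   (RtoC C0 * comp (eval al) (eval bl) t L (eval r) d (IZR N * x)%R (IZR 1 * x)%R)%C).
{ intros r x; rewrite eval_smon, Rmult_0_l, E_0, Cmult_1_r, eval_blk, comp_eval, Rmult_1_l; reflexivity. }
assert (Wal : wiener (eval al) (V / 2)) by (apply wiener_le with (1 := Hal), wiener_eval).
assert (Wbl : wiener (eval bl) (V / 2)) by (apply wiener_le with (1 := Hbl), wiener_eval).
assert (HK1 : 1 <= K) by (unfold K; lra).
assert (HQK : wiener Q K) by (apply wiener_le with (2 := HQ); unfold K; lra).
(* This length keeps exactly the blocks of the modes -1, 0 and 1 of [q], that is, it replaces [q] by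
   1 - cos. *)
exists G, P, (1 * N + D)%Z; split; [lia|].
split; [|split; [|split; [|split; [|split]]]].
- replace C0 with (Cmod (RtoC C0)) by exact HCC.
  apply wiener_scal, wiener_comp; auto.
- unfold P; rewrite norm1_smon, HCC; apply Rmult_le_compat_l; [lra|].
  eapply Rle_trans; [apply norm1_blk with (b := V ^ d); intros; now apply norm1_Psi|].
  rewrite Rmult_comm; apply Rmult_le_compat_l; [lra|unfold K; lra].
- apply wiener_trans with (1 := (wiener_scal (RtoC C0) _ _
    (wiener_comp_diff _ _ _ _ _ _ t L _ _ _ HV HK1 Wa Wb Wal Wbl HQK Da Db HQq d N 1%Z))).
  + rewrite HCC; apply Rle_trans with (1 := Herr), Rmin_l.
  + intros x; unfold P, G; rewrite Heval; ring.
- unfold P; rewrite coef_smon, (coef_blk _ _ _ D) by (auto; unfold N; lia).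
  rewrite (Zdiv_small (0 - 0 + D) N) by (unfold N; lia); rewrite Hq0, Z.mul_0_r.
  change (0 - 0 - 0)%Z with 0%Z; unfold ps.
  destruct (coef_Psi_0 al bl t L D0 delta) with (i := d) as [H _]; auto; try (unfold L, t; nia); [lra| | |].
  + rewrite Hsum; apply (coef_gap_tp p 0).
  + intros l Hl; rewrite Hsum; now apply coef_gap_tp.
  + rewrite H, Cmult_1_l, <- RtoC_mult; f_equal; unfold C0; field; lra.
- intros l Hl; unfold P; rewrite coef_smon, (coef_blk _ _ _ D) by (auto; unfold N; lia).
  rewrite Z.sub_0_r; set (j := ((l + D) / N)%Z).
  rewrite !Cmod_mult, HCC.
  destruct (Z.eq_dec j 0) as [Hj|Hj].
  + rewrite Hj, Hq0, Z.mul_0_r, Z.sub_0_r, Cmod_1, Rmult_1_l; unfold ps.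
    destruct (coef_Psi_0 al bl t L D0 delta) with (i := d) as [_ H]; auto; try (unfold L, t; nia); [lra| | |].
    * rewrite Hsum; apply (coef_gap_tp p 0).
    * intros k Hk; rewrite Hsum; now apply coef_gap_tp.
    * specialize (H l Hl); assert (Hx := Cmod_ge_0 (coef (Psi al bl t L d 0) l)); nra.
  + destruct (Z_lt_le_dec J (Z.abs j)) as [HjJ|HjJ].
    { rewrite (coef_out J q j HqJ HjJ), Cmod_0; lra. }
    assert (H1 := coef_Psi_le al bl t L D0 J (3/4) HDa HDb HD0 ltac:(unfold t; lia)
      ltac:(unfold L; lia) Ca Cb d j (l - N * j) HjJ Hj).
    assert (H2 := Cmod_coef_le q j); fold ps in H1.
    assert (H3 := Cmod_ge_0 (coef q j)); assert (H4 := Cmod_ge_0 (coef (ps j) (l - N * j))).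
    apply Rle_trans with (2 * (K * (3/4) ^ d)); [|lra].
    apply Rmult_le_compat; [lra|now apply Rmult_le_pos|lra|].
    apply Rmult_le_compat; auto; unfold K; lra.
- assert (Hcos : forall y, eval (cut 1 q) y = RtoC (1 - cos y)).
  { intros y; rewrite eval_cut_1, Hq0, Hq1, Hqm.
    assert (HE := cos_IZR_E 1 y); change (- (1))%Z with (-1)%Z in HE.
    replace (IZR 1 * y) with y in HE by ring; replace (IZR (-1) * y) with (- y) in HE by ring.
    transitivity (1 + RtoC (-1/2) * (E y + E (- y)))%C; [ring|].
    rewrite HE, <- RtoC_mult, <- RtoC_plus; f_equal; field. }
  assert (HcosW : wiener (eval (cut 1 q)) K).
  { set (cl := [(0%Z, RtoC 1); (1%Z, RtoC (-1/2)); ((-1)%Z, RtoC (-1/2))]).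
    apply wiener_ext with (eval cl).
    - intros y; rewrite eval_cut_1, Hq0, Hq1, Hqm; unfold cl, eval, lsum; cbn [fold_right fst snd].
      rewrite Rmult_0_l, E_0, Rmult_1_l; replace (-1 * y) with (- y) by ring; ring.
    - apply wiener_le with (2 := wiener_eval cl); unfold cl, norm1; cbn [fold_right fst snd].
      rewrite Cmod_1, !Cmod_R, !(Rabs_left (-1/2)) by lra; unfold K; lra. }
  (* The inner function is now the same on both sides; only the switches are approximated. *)
  assert (HW0 : wiener (fun y => eval (cut 1 q) y - eval (cut 1 q) y)%C eta1).
  { apply wiener_le with (Cmod (RtoC 0)); [rewrite Cmod_0; lra|].
    apply wiener_ext with (2 := wiener_const (RtoC 0)); intros y; ring. }
  assert (Hdiff := wiener_scal (RtoC C0) _ _ (wiener_comp_diff _ _ _ _ _ _ t L _ _ _ HV HK1 Wa Wb Wal Wbl HcosW Da Db HW0 d N 1%Z)).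
  intros x; unfold P; rewrite cut_smon_0, cut_blk by (auto; unfold N; lia).
  rewrite Heval; assert (Hx := wiener_sup _ _ x Hdiff); cbv beta in Hx.
  assert (Hx' : Cmod (RtoC C0 * (comp (fun s => RtoC (gap_pos p s)) (fun s => RtoC (gap_neg p s)) t L (eval (cut 1 q)) d
      (IZR N * x)%R (IZR 1 * x)%R - comp (eval al) (eval bl) t L (eval (cut 1 q)) d
      (IZR N * x)%R (IZR 1 * x)%R))%C <= eps / 2).
  { apply Rle_trans with (1 := Hx); rewrite HCC; apply Rle_trans with (1 := Herr), Rmin_r. }
  clear Hx; unfold G.
  (* [w] and [phi] do not depend on the inner function: if [Q phi] is nonzero, then 1 - cos phi is
     small at the same [phi]. In general [C0 * w * (1 - cos phi)] is at most 4, whence the bound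
     5. *)
  destruct (comp_single (gap_pos p) (gap_neg p) t L (gap_pos_neg p) d (IZR N * x) (IZR 1 * x)) as [w [phi [Hw HF]]].
  rewrite (HF Q); rewrite (HF (eval (cut 1 q))), Hcos in Hx'.
  set (X := comp (eval al) (eval bl) t L (eval (cut 1 q)) d (IZR N * x) (IZR 1 * x)) in *.
  assert (Hcp := COS_bound phi).
  assert (Hm : Cmod (RtoC C0 * X)%C <= C0 * (w * (1 - cos phi)) + eps / 2).
  { replace (RtoC C0 * X)%C with (RtoC C0 * (RtoC w * RtoC (1 - cos phi)) +
      - (RtoC C0 * (RtoC w * RtoC (1 - cos phi) - X)))%C by ring.
    eapply Rle_trans; [apply Cmod_triangle|]; rewrite Cmod_opp.
    apply Rplus_le_compat; [|exact Hx'].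
    rewrite <- !RtoC_mult, Cmod_R, Rabs_pos_eq; [lra|].
    apply Rmult_le_pos; [lra|apply Rmult_le_pos; lra]. }
  assert (Hwc : 0 <= w * (1 - cos phi) <= 1 - cos phi) by (split; nra).
  split.
  + apply Rle_trans with (1 := Hm); nra.
  + destruct (HQs phi) as [H0|H0]; [left; rewrite H0; ring|right].
    assert (Hsin : 0 <= sin a <= a).
    { split; [apply sin_ge_0; lra|left; apply sin_lt_x; lra]. }
    assert (sin a ^ 2 <= a ^ 2) by (apply pow_incr; lra).
    assert (a ^ 2 <= eps / 16) by (unfold a; nra).
    apply Rle_trans with (1 := Hm); nra.
Qed.

(** * Assembling the series *)

Definition psterm (c : Z -> C) (n : nat) (x : R) (j : nat) : C :=
  (c (Z.of_nat j - Z.of_nat n)%Z * E (IZR (Z.of_nat j - Z.of_nat n) * x))%C.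

Lemma symm_partial_sum_E (c : Z -> C) (n : nat) (x : R) :
  symm_partial_sum c n x = sum_n (psterm c n x) (2 * n).
Proof. apply sum_n_ext; intros j; unfold psterm; now rewrite Cexp_E. Qed.

Lemma symm_partial_sum_ext (c c' : Z -> C) (n : nat) (x : R) :
  (forall l, (Z.abs l <= Z.of_nat n)%Z -> c l = c' l) ->
  symm_partial_sum c n x = symm_partial_sum c' n x.
Proof.
intros H; apply sum_n_ext_loc; intros j Hj; cbv zeta; rewrite H; [easy|lia].
Qed.

(** This crude bound is enough because [n] stays fixed while [e] tends to 0. *)
Lemma symm_partial_sum_diff (c c' : Z -> C) (n : nat) (x e : R) :
  (forall l, Cmod (c l - c' l) <= e) ->
  Cmod (symm_partial_sum c n x - symm_partial_sum c' n x) <= (INR (2 * n) + 1) * e.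
Proof.
intros H; rewrite !symm_partial_sum_E; generalize (2 * n)%nat; intros K.
assert (Ht : forall j, Cmod (psterm c n x j - psterm c' n x j) <= e).
{ intros j; unfold psterm; set (l := (Z.of_nat j - Z.of_nat n)%Z).
  replace (c l * E (IZR l * x) - c' l * E (IZR l * x))%C with ((c l - c' l) * E (IZR l * x))%C by ring.
  rewrite Cmod_mult, Cmod_E, Rmult_1_r; apply H. }
induction K as [|K IH].
- rewrite !sum_O; simpl; rewrite Rplus_0_l, Rmult_1_l; apply Ht.
- rewrite !sum_Sn, S_INR; specialize (Ht (S K)).
  change plus with Cplus.
  match goal with |- Cmod (?a + ?b - (?a' + ?b'))%C <= _ =>
    replace (a + b - (a' + b'))%C with ((a - a') + (b - b'))%C by ring end.
  eapply Rle_trans; [apply Cmod_triangle|]; lra.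
Qed.

Lemma symm_partial_sum_coef (p : trigpoly) (n : nat) (x : R) :
  symm_partial_sum (coef p) n x = eval (cut (Z.of_nat n) p) x.
Proof.
rewrite symm_partial_sum_E; induction p as [|[l c] p IH].
- change (eval (cut (Z.of_nat n) []) x) with (RtoC 0).
  generalize (2 * n)%nat; intros K; induction K as [|K IH].
  + rewrite sum_O; unfold psterm, coef; simpl; ring.
  + rewrite sum_Sn, IH; unfold psterm, coef; simpl; change plus with Cplus; ring.
- transitivity (plus (sum_n (psterm (fun k => if Z.eq_dec l k then c else 0%C) n x) (2 * n))
    (sum_n (psterm (coef p) n x) (2 * n))).
  { rewrite <- sum_n_plus; apply sum_n_ext; intros j; unfold psterm, coef; simpl.
    change plus with Cplus; ring. }
  rewrite IH; change ((l, c) :: p) with ([(l, c)] ++ p); rewrite cut_app, eval_app.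
  change plus with Cplus; f_equal.
  assert (HK : forall K, @eq C (sum_n (psterm (fun k => if Z.eq_dec l k then c else 0%C) n x) K)
    (if Z_le_dec (- Z.of_nat n) l then if Z_le_dec l (Z.of_nat K - Z.of_nat n)
      then (c * E (IZR l * x))%C else RtoC 0 else RtoC 0)).
  { induction K as [|K IHK].
    - rewrite sum_O; unfold psterm; destruct Z.eq_dec as [Hl|Hl].
      + rewrite <- Hl; destruct Z_le_dec; [|lia]; destruct Z_le_dec; [easy|lia].
      + destruct Z_le_dec; [destruct Z_le_dec; [lia|ring]|ring].
    - rewrite sum_Sn, IHK; change plus with Cplus; unfold psterm at 1; destruct Z.eq_dec as [Hl|Hl].
      + rewrite <- Hl; destruct Z_le_dec; [|lia].
        destruct Z_le_dec; [lia|]; destruct Z_le_dec; [ring|lia].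
      + destruct Z_le_dec; [|ring].
        destruct Z_le_dec; destruct Z_le_dec; try lia; ring. }
  rewrite HK; unfold cut; cbn [filter fst].
  destruct (Z.leb_spec (Z.abs l) (Z.of_nat n)).
  + destruct Z_le_dec; [|lia]; destruct Z_le_dec; [|lia].
    unfold eval; simpl; ring.
  + destruct Z_le_dec; [|easy]; destruct Z_le_dec; [lia|easy].
Qed.

(* sF is the exact function, sf its approximation, sB the norm bound of the next kernel and
   sM the length of the last selected partial sum. *)
Record state := mkstate { sF : R -> C; sf : trigpoly; sB : R; sM : nat }.

(** Multiplication by a kernel of norm [B] turns this error into at most (1/2)^k / 16; the added 1
    also keeps it below (1/2)^k, which bounds the polynomial at the zeros of the exact function. *)
Definition tol (k : nat) (B : R) : R := (1/2) ^ k / (16 * B + 1).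

(** The product of [norm1] and [eps] bounds, at the next step, both the new coefficients and the
    selected partial sum where the new exact function is nonzero. *)
Definition Inv (k : nat) (st : state) : Prop :=
  0 < sB st /\
  (exists eps, 0 < eps /\ norm1 (sf st) * eps <= (1/2) ^ k /\ kernel eps (sB st)) /\
  wiener (fun x => sF st x - eval (sf st) x)%C (tol k (sB st)).

(* [X] is the [sM st']-th partial sum of the product polynomial, before the correction
   that brings [sf st'] close to [sF st']. *)
Definition Next (k : nat) (st st' : state) : Prop :=
  exists X : R -> C,
  (forall x, sF st' x = 0%C \/ Cmod (X x) <= (1/2) ^ k) /\
  (forall x, sF st x = 0%C -> sF st' x = 0%C) /\
  (forall x, Cmod (X x) <= 5 * Cmod (eval (sf st) x)) /\
  (forall x, Cmod (symm_partial_sum (coef (sf st')) (sM st') x - X x) <= (1/2) ^ k) /\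
  (forall m x, (m <= sM st)%nat ->
    Cmod (symm_partial_sum (coef (sf st')) m x - symm_partial_sum (coef (sf st)) m x) <= (1/2) ^ k) /\
  (forall l, Cmod (coef (sf st') l - coef (sf st) l) <= 2 * (1/2) ^ k) /\
  Cmod (coef (sf st') 0 - coef (sf st) 0) <= (1/2) ^ k / 8 /\
  (sM st < sM st')%nat.

Lemma half_pow_pos (k : nat) : 0 < (1/2) ^ k.
Proof. apply pow_lt; lra. Qed.

Lemma next_exists (k : nat) (st : state) : Inv k st -> exists st', Inv (S k) st' /\ Next k st st'.
Proof.
destruct st as [F f B M]; unfold Inv, Next; cbn [sF sf sB sM].
intros [HB [[eps [He [Hfe Hker]]] HF]].
assert (Hk := half_pow_pos k); set (h := (1/2) ^ k) in *.
assert (Hf0 := norm1_ge_0 f).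
destruct (Hker (h / (16 * (norm1 f + 1)))) as [G [P [m [Hm [HG [HP [HGP [HP0 [HPl Hcut]]]]]]]]].
{ apply Rdiv_lt_0_compat; lra. }
destruct (degle_ex f) as [Df [HDf0 HDf]].
(* Since [P] has mean 1, block 0 of the product is [f] itself. With [D] at least [M], the partial
   sums up to length [M] are the same for [f] and [g]. *)
set (D := Z.max Df (Z.of_nat M)); set (N := (2 * D + 1)%Z).
assert (HD0 : (0 <= D)%Z) by lia.
assert (HD : degle D f) by (apply (degle_le Df); [lia|exact HDf]).
set (g := blk (fun _ => f) N P).
set (F' := fun x => (F x * G (IZR N * x)%R)%C).
(* Two errors of h / 16: that of [f] times the kernel norm, and the norm of [f] times that of the
   kernel approximation. *)
set (kap := h / 8).
assert (HF' : wiener (fun x => F' x - eval g x)%C kap).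
{ apply wiener_trans with (1 := wiener_plus _ _ _ _ (wiener_mult _ _ _ _ HF (wiener_dil N _ _ HG))
    (wiener_mult _ _ _ _ (wiener_eval f) (wiener_dil N _ _ HGP))).
  - unfold tol; fold h.
    assert (H1 : h / (16 * B + 1) * B <= h / 16).
    { apply Rmult_le_reg_r with (16 * (16 * B + 1)); [lra|].
      replace (h / (16 * B + 1) * B * (16 * (16 * B + 1))) with (h * (16 * B)) by (field; lra).
      replace (h / 16 * (16 * (16 * B + 1))) with (h * (16 * B + 1)) by (field; lra).
      apply Rmult_le_compat_l; lra. }
    assert (H2 : norm1 f * (h / (16 * (norm1 f + 1))) <= h / 16).
    { apply Rmult_le_reg_r with (16 * (norm1 f + 1)); [lra|].
      replace (norm1 f * (h / (16 * (norm1 f + 1))) * (16 * (norm1 f + 1))) with (h * norm1 f) by (field; lra).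
      replace (h / 16 * (16 * (norm1 f + 1))) with (h * (norm1 f + 1)) by (field; lra).
      apply Rmult_le_compat_l; lra. }
    unfold kap; lra.
  - intros x; unfold F', g; rewrite eval_blk_const; ring. }
(* Bounds the norm of [g ++ r] before [r] is chosen, [r] having norm at most h / 8 <= 1. The order
   is forced: the accuracy of [r] depends on [B'], which depends on [A]. *)
set (A := norm1 P * norm1 f + 1).
assert (HA : 1 <= A).
{ assert (0 <= norm1 P * norm1 f) by (apply Rmult_le_pos; [apply norm1_ge_0|lra]); unfold A; lra. }
assert (Hh1 : (1/2) ^ S k <= 1).
{ generalize (pow_incr (1/2) 1 (S k)); rewrite pow1; lra. }
assert (Hk' := half_pow_pos (S k)).
destruct (kernel_exists ((1/2) ^ S k / A)) as [B' [HB' Hker']].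
{ split; [apply Rdiv_lt_0_compat; lra|].
  apply Rmult_le_reg_r with A; [lra|].
  replace ((1/2) ^ S k / A * A) with ((1/2) ^ S k) by (field; lra); lra. }
assert (Htol : 0 < tol (S k) B') by (apply Rdiv_lt_0_compat; lra).
destruct (wiener_split _ _ _ Htol HF') as [r [Hr HFr]].
assert (Hh1' : h <= 1).
{ generalize (pow_incr (1/2) 1 k); rewrite pow1; unfold h; lra. }
set (M' := Z.to_nat (m * N + D)).
assert (HM' : Z.of_nat M' = (m * N + D)%Z) by (unfold M'; rewrite Z2Nat.id; unfold N; nia).
assert (Hgl : forall l, coef g l = (coef P ((l + D) / N) * coef f (l - N * ((l + D) / N)))%C)
  by (intros l; apply coef_blk; auto; unfold N; lia).
assert (Hlow : forall l, (Z.abs l <= D)%Z -> coef g l = coef f l).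
{ intros l Hl; rewrite Hgl, (Zdiv_small (l + D) N) by (unfold N; lia).
  rewrite HP0, Z.mul_0_r, Z.sub_0_r; ring. }
assert (Hr8 : norm1 r <= h / 8) by exact Hr.
exists (mkstate F' (g ++ r) B' M'); cbn [sF sf sB sM].
split; [split; [exact HB'|split]|].
- exists ((1/2) ^ S k / A); split; [apply Rdiv_lt_0_compat; lra|split; [|exact Hker']].
  assert (HAn : norm1 (g ++ r) <= A).
  { rewrite norm1_app; unfold A; apply Rplus_le_compat; [|lra].
    apply norm1_blk; intros; lra. }
  apply Rle_trans with (A * ((1/2) ^ S k / A)); [|right; field; lra].
  apply Rmult_le_compat_r; [left; apply Rdiv_lt_0_compat; lra|exact HAn].
- apply wiener_ext with (2 := HFr); intros x; rewrite eval_app; ring.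
- exists (fun x => eval f x * eval (cut m P) (IZR N * x)%R)%C.
  split; [|split; [|split; [|split; [|split; [|split; [|split]]]]]].
  + intros x; destruct (proj2 (Hcut (IZR N * x))) as [H0|H0].
    * left; unfold F'; rewrite H0; ring.
    * right; rewrite Cmod_mult; apply Rle_trans with (norm1 f * eps); [|exact Hfe].
      apply Rmult_le_compat; auto using Cmod_ge_0, Cmod_eval_le.
  + intros x H0; unfold F'; rewrite H0; ring.
  + intros x; rewrite Cmod_mult, Rmult_comm; apply Rmult_le_compat_r; [apply Cmod_ge_0|apply Hcut].
  + intros x; rewrite symm_partial_sum_coef, HM', cut_app, eval_app; unfold g.
    rewrite cut_blk, eval_blk_const by (auto; unfold N; lia).
    match goal with |- Cmod (?u + ?v - ?u)%C <= _ => replace (u + v - u)%C with v by ring end.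
    eapply Rle_trans; [apply Cmod_eval_le|].
    eapply Rle_trans; [apply norm1_cut|lra].
  + intros n x Hn; rewrite <- (symm_partial_sum_ext (coef g) (coef f) n x) by (intros l Hl; apply Hlow; lia).
    rewrite !symm_partial_sum_coef, cut_app, eval_app.
    match goal with |- Cmod (?u + ?v - ?u)%C <= _ => replace (u + v - u)%C with v by ring end.
    eapply Rle_trans; [apply Cmod_eval_le|].
    eapply Rle_trans; [apply norm1_cut|lra].
  + intros l; rewrite coef_app.
    replace (coef g l + coef r l - coef f l)%C with ((coef g l - coef f l) + coef r l)%C by ring.
    eapply Rle_trans; [apply Cmod_triangle|].
    assert (H1 := Cmod_coef_le r l).
    assert (H2 : Cmod (coef g l - coef f l) <= h); [|lra].
    destruct (Z_le_dec (Z.abs l) D) as [Hl|Hl].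
    * rewrite Hlow by exact Hl; replace (coef f l - coef f l)%C with (RtoC 0) by ring; rewrite Cmod_0; lra.
    * rewrite (coef_out D f l HD) by lia.
      replace (coef g l - 0)%C with (coef g l) by ring; rewrite Hgl.
      set (j := ((l + D) / N)%Z); destruct (Z.eq_dec j 0) as [Hj|Hj].
      -- rewrite Hj, Z.mul_0_r, Z.sub_0_r, (coef_out D f l HD) by lia.
         rewrite Cmult_0_r, Cmod_0; lra.
      -- rewrite Cmod_mult, Rmult_comm; apply Rle_trans with (norm1 f * eps); [|exact Hfe].
         apply Rmult_le_compat; auto using Cmod_ge_0, Cmod_coef_le.
  + rewrite coef_app, Hlow by lia.
    replace (coef f 0 + coef r 0 - coef f 0)%C with (coef r 0) by ring.
    apply Rle_trans with (2 := Hr8), Cmod_coef_le.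
  + apply Nat2Z.inj_lt; rewrite HM'; unfold N; nia.
Qed.

Lemma state_sequence : exists st : nat -> state,
  (forall x, sF (st 0%nat) x = 1%C) /\ coef (sf (st 0%nat)) 0 = 1%C /\
  forall k, Inv k (st k) /\ Next k (st k) (st (S k)).
Proof.
destruct (kernel_exists 1) as [B [HB Hker]]; [lra|].
set (st0 := mkstate (fun _ => 1%C) [(0%Z, RtoC 1)] B 0).
assert (H0 : Inv 0 st0).
{ split; [exact HB|split].
  - exists 1; split; [lra|split; [|exact Hker]]; simpl; rewrite Cmod_1; lra.
  - apply wiener_trans with (1 := wiener_const (RtoC 0)).
    + rewrite Cmod_0; apply Rlt_le, Rdiv_lt_0_compat; [apply half_pow_pos|simpl; lra].
    + intros x; cbn [sF sf st0]; rewrite eval_one; ring. }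
(* [epsilon] makes the recursion total, so states need not carry a proof of the invariant. *)
set (st := nat_rect (fun _ => state) st0
  (fun k s => epsilon (inhabits s) (fun s' => Inv (S k) s' /\ Next k s s'))).
assert (Hspec : forall k, Inv k (st k) -> Inv (S k) (st (S k)) /\ Next k (st k) (st (S k))).
{ intros k Hk; exact (epsilon_spec (inhabits (st k)) _ (next_exists k _ Hk)). }
assert (HI : forall k, Inv k (st k)).
{ induction k as [|k IH]; [exact H0|now apply Hspec]. }
exists st; split; [easy|split]; [unfold coef; simpl; ring|].
intros k; split; [apply HI|apply Hspec, HI].
Qed.

(** * Passage to the limit *)

Lemma telescope_bound (u : nat -> C) (K : R) :
  (forall n, Cmod (u (S n) - u n) <= K * (1/2) ^ n) ->
  forall n m, Cmod (u (n + m)%nat - u n) <= 2 * K * (1/2) ^ n * (1 - (1/2) ^ m).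
Proof.
intros Hu n; induction m as [|m IH].
- rewrite Nat.add_0_r; replace (u n - u n)%C with (RtoC 0) by ring; rewrite Cmod_0; simpl; lra.
- rewrite Nat.add_succ_r.
  replace (u (S (n + m)) - u n)%C with ((u (S (n + m)) - u (n + m)%nat) + (u (n + m)%nat - u n))%C by ring.
  eapply Rle_trans; [apply Cmod_triangle|].
  specialize (Hu (n + m)%nat); rewrite pow_add in Hu; simpl; lra.
Qed.

Lemma geometric_limit (u : nat -> C) (K : R) :
  (forall n, Cmod (u (S n) - u n) <= K * (1/2) ^ n) ->
  exists l, forall n, Cmod (l - u n) <= 4 * K * (1/2) ^ n.
Proof.
intros Hu; assert (Ht := telescope_bound u K Hu).
assert (HK : 0 <= K) by (specialize (Hu 0%nat); generalize (Cmod_ge_0 (u 1%nat - u 0%nat)); simpl in Hu; lra).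
assert (Hr : forall v : nat -> R,
  (forall n m, Rabs (v (n + m)%nat - v n) <= Cmod (u (n + m)%nat - u n)) ->
  exists l, forall n, Rabs (l - v n) <= 2 * K * (1/2) ^ n).
{ intros v Hv.
  assert (Hv' : forall n m, Rabs (v (n + m)%nat - v n) <= 2 * K * (1/2) ^ n).
  { intros n m; apply Rle_trans with (1 := Hv n m), Rle_trans with (1 := Ht n m).
    assert (Hn := half_pow_pos n); assert (Hm := half_pow_pos m).
    assert (0 <= K * (1/2) ^ n) by (apply Rmult_le_pos; lra).
    assert (0 <= K * (1/2) ^ n * (1/2) ^ m) by (apply Rmult_le_pos; lra); lra. }
  destruct (Rcomplete.R_complete v) as [l Hl].
  { intros e He; destruct (pow_lt_eps (1/2) (4 * K + 1) (e / 2)) as [n Hn]; [lra|lra|].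
    assert (Hp := half_pow_pos n).
    exists n; intros a b Ha Hb; unfold Rdist.
    assert (Ha' := Hv' n (a - n)%nat); assert (Hb' := Hv' n (b - n)%nat).
    replace (n + (a - n))%nat with a in Ha' by lia; replace (n + (b - n))%nat with b in Hb' by lia.
    replace (v a - v b) with ((v a - v n) - (v b - v n)) by ring.
    eapply Rle_lt_trans; [apply Rabs_triang|]; rewrite Rabs_Ropp; lra. }
  exists l; intros n; apply Rnot_lt_le; intros H.
  destruct (Hl (Rabs (l - v n) - 2 * K * (1/2) ^ n)) as [n0 Hn0]; [lra|].
  specialize (Hn0 (n + n0)%nat ltac:(lia)); specialize (Hv' n n0); unfold Rdist in Hn0.
  assert (Htr := Rabs_triang (l - v (n + n0)%nat) (v (n + n0)%nat - v n)).
  replace (l - v (n + n0)%nat + (v (n + n0)%nat - v n)) with (l - v n) in Htr by ring.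
  rewrite Rabs_minus_sym in Hn0; lra. }
destruct (Hr (fun n => Re (u n))) as [a Ha].
{ intros n m; eapply Rle_trans; [|apply re_le_Cmod].
  right; f_equal; unfold Cminus; now rewrite re_plus, re_opp. }
destruct (Hr (fun n => Im (u n))) as [b Hb].
{ intros n m; eapply Rle_trans; [|eapply Rle_trans; [apply Rmax_r|apply Rmax_Cmod]].
  right; f_equal; unfold Cminus; now rewrite im_plus, im_opp. }
exists (a, b); intros n; specialize (Ha n); specialize (Hb n).
replace ((a, b) - u n)%C with (RtoC (a - Re (u n)) + Ci * RtoC (b - Im (u n)))%C.
2:{ destruct (u n) as [y z]; unfold Cminus, Cplus, Copp, Cmult, Ci, RtoC, Re, Im; simpl; f_equal; ring. }
eapply Rle_trans; [apply Cmod_triangle|].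
rewrite Cmod_mult, !Cmod_R, Cmod_Ci; lra.
Qed.

Theorem theorem1 :
  exists (c : Z -> C) (n : nat -> nat),
    (exists l : Z, c l <> RtoC 0) /\
    filterlim c Z_at_infinity (locally (RtoC 0)) /\
    (forall k : nat, (0 < n k)%nat) /\
    filterlim n eventually eventually /\
    (forall x : R, 0 <= x <= 2 * PI ->
       filterlim (fun k : nat => symm_partial_sum c (n k) x)
         eventually (locally (RtoC 0))).
Proof.
destruct state_sequence as [st [HF0 [Hc0 Hst]]].
pose (f := fun k => sf (st k)).
assert (Hlim : forall l, exists a, forall k, Cmod (a - coef (f k) l) <= 8 * (1/2) ^ k).
{ intros l; destruct (geometric_limit (fun k => coef (f k) l) 2) as [a Ha].
  - intros k; destruct (Hst k) as [_ [X [_ [_ [_ [_ [_ [H _]]]]]]]]; apply H.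
  - exists a; intros k; specialize (Ha k); lra. }
pose (c := fun l => proj1_sig (constructive_indefinite_description _ (Hlim l))).
assert (Hc : forall l k, Cmod (c l - coef (f k) l) <= 8 * (1/2) ^ k).
{ intros l; exact (proj2_sig (constructive_indefinite_description _ (Hlim l))). }
pose (n := fun k => sM (st (S k))).
assert (HM : forall k, (sM (st k) < sM (st (S k)))%nat).
{ intros k; destruct (Hst k) as [_ [X [_ [_ [_ [_ [_ [_ [_ H]]]]]]]]]; exact H. }
assert (HMk : forall k, (k <= sM (st k))%nat).
{ induction k as [|k IH]; [lia|]; specialize (HM k); lia. }
assert (Hball : forall (u : C) (eps : posreal), Cmod u < eps -> ball (RtoC 0) eps u).
{ intros u eps Hu; apply C_NormedModule_mixin_compat1.
  change (Cmod (u - 0)%C < eps); now replace (u - 0)%C with u by ring. }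
exists c, n; split; [|split; [|split; [|split]]].
- exists 0%Z; intros H0.
  (* The constant coefficient starts at 1 and moves by less than 1/4 in five steps; by then the
     distance to its limit is at most 8 / 32 = 1/4, so the limit is not 0. *)
  assert (Ht := telescope_bound (fun k => coef (f k) 0) (1/8)).
  specialize (Ht (fun k => ltac:(destruct (Hst k) as [_ [X [_ [_ [_ [_ [_ [_ [H _]]]]]]]]];
    unfold f; lra)) 0%nat 5%nat).
  specialize (Hc 0%Z 5%nat); rewrite H0 in Hc; cbn [Nat.add] in Ht.
  unfold f at 2 in Ht; rewrite Hc0 in Ht.
  assert (Htr := Cmod_triangle (coef (f 5%nat) 0 - 1) (0 - coef (f 5%nat) 0)).
  replace (coef (f 5%nat) 0 - 1 + (0 - coef (f 5%nat) 0))%C with (- (1))%C in Htr by ring.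
  rewrite Cmod_opp, Cmod_1 in Htr; simpl in Hc, Ht; lra.
- apply filterlim_locally; intros eps.
  destruct (pow_lt_eps (1/2) 8 (eps / 2)) as [k Hk]; [lra|generalize (cond_pos eps); lra|].
  destruct (degle_ex (f k)) as [D [HD0 HD]].
  exists (Z.to_nat (D + 1)); intros l Hl; apply Hball.
  specialize (Hc l k); rewrite (coef_out D _ l HD) in Hc by lia.
  replace (c l - 0)%C with (c l) in Hc by ring.
  generalize (cond_pos eps); lra.
- intros k; unfold n; specialize (HM k); lia.
- intros P [N HN]; exists N; intros k Hk; apply HN.
  unfold n; specialize (HMk (S k)); lia.
- intros x _.
  assert (Hlow : forall k m, Cmod (symm_partial_sum (coef (f (S k + m)%nat)) (n k) x -
      symm_partial_sum (coef (f (S k))) (n k) x) <= (1/2) ^ k).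
  { intros k m.
    (* The later corrections sum to at most 2 (1/2)^(k+1) = (1/2)^k, as the length [n k] is
       protected at all steps from [S k] on. *)
    assert (Ht := telescope_bound
      (fun j => symm_partial_sum (coef (f (S k + j)%nat)) (n k) x) ((1/2) ^ S k)).
    assert (Hmono : forall j, (n k <= sM (st (S k + j)))%nat).
    { induction j as [|j IH]; [rewrite Nat.add_0_r; unfold n; lia|].
      rewrite Nat.add_succ_r; specialize (HM (S k + j)%nat); lia. }
    specialize (Ht (fun j => ltac:(destruct (Hst (S k + j)%nat) as [_ [X [_ [_ [_ [_ [H _]]]]]]];
      specialize (H (n k) x (Hmono j)); rewrite pow_add in H;
      rewrite (Nat.add_succ_r (S k) j); exact H)) 0%nat m).
    cbv beta in Ht; rewrite Nat.add_0_l, Nat.add_0_r in Ht.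
    apply Rle_trans with (1 := Ht); assert (Hk := half_pow_pos k); assert (Hm := half_pow_pos m).
    assert (0 <= (1/2) ^ k * (1/2) ^ m) by (apply Rmult_le_pos; lra); simpl; lra. }
  assert (Hsum : forall k, Cmod (symm_partial_sum c (n k) x -
      symm_partial_sum (coef (f (S k))) (n k) x) <= 2 * (1/2) ^ k).
  { intros k; assert (Hk := half_pow_pos k).
    destruct (pow_lt_eps (1/2) ((INR (2 * n k) + 1) * 8) ((1/2) ^ k)) as [J HJ]; [lra|lra|].
    assert (H1 := symm_partial_sum_diff c (coef (f (S k + J)%nat)) (n k) x (8 * (1/2) ^ J)).
    assert (H2 : (1/2) ^ (S k + J) <= (1/2) ^ J).
    { rewrite pow_add; generalize (pow_incr (1/2) 1 (S k)) (half_pow_pos J); rewrite pow1; intros; nra. }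
    assert (H3 : 8 * (1/2) ^ (S k + J) <= 8 * (1/2) ^ J) by lra.
    specialize (H1 (fun l => Rle_trans _ _ _ (Hc l (S k + J)%nat) H3)).
    specialize (Hlow k J).
    replace (symm_partial_sum c (n k) x - symm_partial_sum (coef (f (S k))) (n k) x)%C with
      ((symm_partial_sum c (n k) x - symm_partial_sum (coef (f (S k + J)%nat)) (n k) x) +
       (symm_partial_sum (coef (f (S k + J)%nat)) (n k) x - symm_partial_sum (coef (f (S k))) (n k) x))%C by ring.
    eapply Rle_trans; [apply Cmod_triangle|]; lra. }
  (* 8 = 2 + 1 + 5: passage to the limit coefficients, correction [r], and the product [X]. *)
  assert (Hmain : exists k0, forall k, (k0 <= k)%nat -> Cmod (symm_partial_sum c (n k) x) <= 8 * (1/2) ^ k).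
  { assert (HX : exists k0, forall k, (k0 <= k)%nat -> exists X : C, Cmod X <= 5 * (1/2) ^ k /\
      Cmod (symm_partial_sum (coef (f (S k))) (n k) x - X) <= (1/2) ^ k).
    (* A zero of an exact function persists, and from then on [f k] is at most [tol] at x, so the
       factor 5 is harmless. Otherwise the small alternative for [X] holds at every step. *)
    { destruct (classic (exists k0, sF (st k0) x = 0%C)) as [[k0 H0]|Hn].
      - exists k0.
        assert (HFz : forall k, (k0 <= k)%nat -> sF (st k) x = 0%C).
        { induction 1 as [|k Hk IH]; [exact H0|].
          destruct (Hst k) as [_ [X [_ [H _]]]]; now apply H. }
        intros k Hk; destruct (Hst k) as [[HB [_ HI]] [X [_ [_ [H5 [H _]]]]]].
        exists (X x); split; [|apply H].
        apply Rle_trans with (1 := H5 x), Rmult_le_compat_l; [lra|].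
        assert (Hs := wiener_sup _ _ x HI); cbv beta in Hs; rewrite (HFz k Hk) in Hs.
        replace (0 - eval (sf (st k)) x)%C with (- eval (sf (st k)) x)%C in Hs by ring.
        rewrite Cmod_opp in Hs; apply Rle_trans with (1 := Hs).
        unfold tol; assert (Hp := half_pow_pos k).
        apply Rmult_le_reg_r with (16 * sB (st k) + 1); [lra|].
        replace ((1/2) ^ k / (16 * sB (st k) + 1) * (16 * sB (st k) + 1)) with ((1/2) ^ k) by (field; lra).
        nra.
      - exists 0%nat; intros k _; destruct (Hst k) as [_ [X [H1 [_ [_ [H _]]]]]].
        exists (X x); split; [|apply H].
        assert (Hp := half_pow_pos k).
        destruct (H1 x) as [Hz|Hz]; [elim Hn; now exists (S k)|lra]. }
    destruct HX as [k0 HX]; exists k0; intros k Hk; destruct (HX k Hk) as [X [H1 H2]].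
    specialize (Hsum k).
    replace (symm_partial_sum c (n k) x) with
      ((symm_partial_sum c (n k) x - symm_partial_sum (coef (f (S k))) (n k) x) +
       ((symm_partial_sum (coef (f (S k))) (n k) x - X) + X))%C by ring.
    eapply Rle_trans; [apply Cmod_triangle|].
    eapply Rle_trans; [apply Rplus_le_compat_l, Cmod_triangle|]; lra. }
  destruct Hmain as [k0 Hmain].
  apply filterlim_locally; intros eps.
  destruct (pow_lt_eps (1/2) 8 (eps / 2)) as [k1 Hk1]; [lra|generalize (cond_pos eps); lra|].
  exists (k0 + k1)%nat; intros k Hk; apply Hball.
  specialize (Hmain k ltac:(lia)).
  assert ((1/2) ^ k <= (1/2) ^ k1).
  { replace k with (k1 + (k - k1))%nat by lia; rewrite pow_add.
    generalize (pow_incr (1/2) 1 (k - k1)) (half_pow_pos k1); rewrite pow1; intros; nra. }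
  generalize (cond_pos eps); lra.
Qed.
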